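(* Let $p,q>1$, $R>0$, let $B_R\subset\mathbb{R}^n$ be the open ball of radius $R$ centered at the origin, and let $\eta$ be the outward unit normal on $\partial B_R$. Let $u_0,v_0$ be smooth, radially symmetric, nonzero, nonnegative functions on $\overline{B}_R$ such that $\Delta u_0\ge 0$, $\Delta v_0\ge 0$, $u_{0r}(|x|)\ge 0$ and $v_{0r}(|x|)\ge 0$ for $x\in\overline{B}_R$. Let $(u,v)$ be a solution of $$\begin{cases} u_t=\Delta u,\quad v_t=\Delta v, & (x,t)\in B_R\times(0,T),\\ \dfrac{\partial u}{\partial\eta}=e^{v^p},\quad \dfrac{\partial v}{\partial\eta}=e^{u^q}, & (x,t)\in\partial B_R\times(0,T),\\ u(x,0)=u_0(x),\quad v(x,0)=v_0(x), & x\in B_R,\end{cases}$$ which blows up in finite time $T$. Then $(u,v)$ blows up only on the boundary, i.e. every blow-up point of $(u,v)$ lies on $\partial B_R$.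
   Context: Solutions are classical solutions with $u,v\ge 0$: $u,v$ are continuous on $\overline{B}_R\times[0,T)$, twice continuously differentiable in $x$ and once in $t$ in $B_R\times(0,T)$, with spatial gradient continuous up to $\partial B_R$ for $t\in(0,T)$, and the equations hold pointwise. For a radially symmetric function $w$, $w_r$ denotes the derivative with respect to $r=|x|$. ''$(u,v)$ blows up in finite time $T$'' means that $T<\infty$ is the maximal existence time of the solution and $\limsup_{t\to T^-}\left(\max_{\overline{B}_R}u(\cdot,t)+\max_{\overline{B}_R}v(\cdot,t)\right)=\infty$. A point $x\in\overline{B}_R$ is a blow-up point of $(u,v)$ if there exist $x_k\in\overline{B}_R$ and $t_k\in(0,T)$ with $x_k\to x$, $t_k\to T$ and $u(x_k,t_k)+v(x_k,t_k)\to\infty$. *)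

(* Defs.v *)
From HB Require Import structures.
From mathcomp Require Import all_boot all_order all_algebra.
From mathcomp Require Import all_classical all_reals all_analysis.

Set Implicit Arguments.
Unset Strict Implicit.
Unset Printing Implicit Defensive.

Import Order.TTheory GRing.Theory Num.Theory.
Import numFieldNormedType.Exports.

Local Open Scope classical_set_scope.
Local Open Scope ring_scope.

(* The norm `|x| of 'rV[K]_n in MathComp-Analysis is the sup norm (it induces
   the same topology), so balls and spheres are defined from enorm. *)
Definition enorm (K : realType) (n : nat) (x : 'rV[K]_n) : K :=
  Num.sqrt (\sum_(i < n) x 0 i ^+ 2).

Definition eball (K : realType) (n : nat) (R : K) : set 'rV[K]_n :=
  [set x | enorm x < R].

Definition cball (K : realType) (n : nat) (R : K) : set 'rV[K]_n :=
  [set x | enorm x <= R].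

Definition esphere (K : realType) (n : nat) (R : K) : set 'rV[K]_n :=
  [set x | enorm x = R].

Definition partial (K : realType) (n : nat) (i : 'I_n) (f : 'rV[K]_n -> K)
    (x : 'rV[K]_n) : K := 'D_(delta_mx 0 i) f x.

Definition laplacian (K : realType) (n : nat) (f : 'rV[K]_n -> K)
    (x : 'rV[K]_n) : K := \sum_(i < n) partial i (partial i f) x.

Definition iter_partial (K : realType) (n : nat) (s : seq 'I_n)
    (f : 'rV[K]_n -> K) : 'rV[K]_n -> K := foldr (@partial K n) f s.

Definition continuous_up_to (K : realType) (n : nat) (R : K)
    (f : 'rV[K]_n -> K) : Prop :=
  exists g : 'rV[K]_n -> K,
    {within cball R, continuous g} /\ (forall x, eball R x -> g x = f x).

(* C^oo of the closed ball: all iterated partial derivatives exist in the open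
   ball and extend continuously to the closed one. The values of f outside the
   closed ball are irrelevant. *)
Definition smooth_cball (K : realType) (n : nat) (R : K) (f : 'rV[K]_n -> K) :
    Prop :=
  {within cball R, continuous f} /\
  forall s : seq 'I_n,
    (forall i x, eball R x -> derivable (iter_partial s f) x (delta_mx 0 i)) /\
    continuous_up_to R (iter_partial s f).

Definition radially_symmetric (K : realType) (n : nat) (R : K)
    (w : 'rV[K]_n -> K) : Prop :=
  forall x y, cball R x -> cball R y -> enorm x = enorm y -> w x = w y.

(* w_r(r) for r in [0, R]: derivative of the profile s |-> w (s e), e a unit
   vector, one-sided at r = 0 and r = R. For a radially symmetric w it does not
   depend on e. *)
Definition radial_derive (K : realType) (n : nat) (R : K) (w : 'rV[K]_n -> K)
    (e : 'rV[K]_n) (r : K) : K :=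
  lim ((fun s : K => (s - r)^-1 * (w (s *: e) - w (r *: e)))
         @ within `[0, R] (r^')).

Record initial_datum (K : realType) (n : nat) (R : K) (w : 'rV[K]_n -> K) :
    Prop := InitialDatum {
  id_smooth : smooth_cball R w;
  id_radial : radially_symmetric R w;
  id_nonzero : exists2 x, cball R x & w x != 0;
  id_ge0 : forall x, cball R x -> 0 <= w x;
  id_laplacian_ge0 : forall x, eball R x -> 0 <= laplacian w x;
  id_radial_derive_ge0 : forall (x e : 'rV[K]_n),
    cball R x -> enorm e = 1 -> 0 <= radial_derive R w e (enorm x)
}.

(* Functions of (x, t) are total; only their values for x in the closed ball
   and t in [0, T) matter. *)
Record classical_regularity (K : realType) (n : nat) (R T : K)
    (u : 'rV[K]_n -> K -> K) : Prop := ClassicalRegularity {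
  cr_cont : {within cball R `*` `[0, T[,
    continuous (fun z : 'rV[K]_n * K => u z.1 z.2)};
  cr_dert : forall x t, eball R x -> 0 < t < T -> derivable (u x) t 1;
  cr_dert_cont : {within eball R `*` `]0, T[,
    continuous (fun z : 'rV[K]_n * K => 'D_1 (u z.1) z.2)};
  cr_derx : forall i x t, eball R x -> 0 < t < T ->
    derivable (u^~ t) x (delta_mx 0 i);
  cr_derx_cont : forall i, {within eball R `*` `]0, T[,
    continuous (fun z : 'rV[K]_n * K => partial i (u^~ z.2) z.1)};
  cr_derxx : forall i j x t, eball R x -> 0 < t < T ->
    derivable (partial i (u^~ t)) x (delta_mx 0 j);
  cr_derxx_cont : forall i j, {within eball R `*` `]0, T[,
    continuous (fun z : 'rV[K]_n * K =>
      partial j (partial i (u^~ z.2)) z.1)};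
  cr_grad : forall i t, 0 < t < T -> continuous_up_to R (partial i (u^~ t))
}.

Definition outward_normal (K : realType) (n : nat) (x : 'rV[K]_n) : 'rV[K]_n :=
  (enorm x)^-1 *: x.

(* The derivative along the outward normal is taken from inside the ball. *)
Definition has_normal_derivative (K : realType) (n : nat) (w : 'rV[K]_n -> K)
    (x : 'rV[K]_n) (l : K) : Prop :=
  h^-1 * (w x - w (x - h *: outward_normal x)) @[h --> 0^'+] --> l.

Record solution (K : realType) (n : nat) (p q R : K) (u0 v0 : 'rV[K]_n -> K)
    (T : K) (u v : 'rV[K]_n -> K -> K) : Prop := Solution {
  sol_T_gt0 : 0 < T;
  sol_regu : classical_regularity R T u;
  sol_regv : classical_regularity R T v;
  sol_u_ge0 : forall x t, cball R x -> 0 <= t < T -> 0 <= u x t;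
  sol_v_ge0 : forall x t, cball R x -> 0 <= t < T -> 0 <= v x t;
  sol_heatu : forall x t, eball R x -> 0 < t < T ->
    'D_1 (u x) t = laplacian (u^~ t) x;
  sol_heatv : forall x t, eball R x -> 0 < t < T ->
    'D_1 (v x) t = laplacian (v^~ t) x;
  sol_bdu : forall x t, esphere R x -> 0 < t < T ->
    has_normal_derivative (u^~ t) x (expR (v x t `^ p));
  sol_bdv : forall x t, esphere R x -> 0 < t < T ->
    has_normal_derivative (v^~ t) x (expR (u x t `^ q));
  sol_initu : forall x, eball R x -> u x 0 = u0 x;
  sol_initv : forall x, eball R x -> v x 0 = v0 x
}.

Definition maximal_existence_time (K : realType) (n : nat) (p q R : K)
    (u0 v0 : 'rV[K]_n -> K) (T : K) (u v : 'rV[K]_n -> K -> K) : Prop :=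
  ~ exists T' u' v', [/\ T < T',
      solution p q R u0 v0 T' u' v' &
      forall x t, cball R x -> 0 <= t < T ->
        u' x t = u x t /\ v' x t = v x t].

Definition max_cball (K : realType) (n : nat) (R : K) (w : 'rV[K]_n -> K) : K :=
  sup (w @` cball R).

Definition blows_up_at (K : realType) (n : nat) (p q R : K)
    (u0 v0 : 'rV[K]_n -> K) (T : K) (u v : 'rV[K]_n -> K -> K) : Prop :=
  maximal_existence_time p q R u0 v0 T u v /\
  limf_esup (fun t : K => (max_cball R (u^~ t) + max_cball R (v^~ t))%:E) T^'-
    = +oo%E.

Definition blow_up_point (K : realType) (n : nat) (R T : K)
    (u v : 'rV[K]_n -> K -> K) (x : 'rV[K]_n) : Prop :=
  cball R x /\
  exists (y : nat -> 'rV[K]_n) (s : nat -> K),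
    [/\ forall k, cball R (y k) /\ 0 < s k < T,
        y @ \oo --> x,
        s @ \oo --> T &
        u (y k) (s k) + v (y k) (s k) @[k --> \oo] --> +oo].

(* Main.v *)
(** All comparisons are made at a first touching time: two continuous functions
    on a compact set, strictly ordered at the initial time, touch for the first
    time at a point where either the heat equation or the boundary flux is
    contradicted.

    Radial monotonicity (|x| <= |y| implies u(x,t) <= u(y,t), and likewise for v)
    comes from doubling the variables: u(x,t) - u(y,t) stays below
    eps e^(la t) G(x) on {|x| <= |y| <= R}.  When |x| = |y| one moves along the
    pairs (z, zQ), Q being the reflection that exchanges x and y, so
    that second derivatives of u suffice.

    If u(x0,t0) >= 2M with |x0| <= r < R, monotonicity gives u >= 2M on
    r <= |x| <= R.  Explicit subsolutions, quadratic in |x|^2, keep u >= M/2 on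
    the boundary during a time tau and make v large there; if M tau exceeds a
    constant, from time t0 + tau on both u and v dominate a common barrier that
    blows up at t0 + 2 tau.  As the solution exists up to T, this forces
    u(x,t) <= C/(T-t) for |x| <= r, and symmetrically for v.

    The supersolution C1/((r^2-|x|^2)^2 + C2(T-t)) of Hu and Yin then bounds u
    on every smaller ball up to time T. *)

Require Import Defs.
From HB Require Import structures.
From mathcomp Require Import all_boot all_order all_algebra.
From mathcomp Require Import all_classical all_reals all_analysis.
From mathcomp Require Import ring lra.

Set Implicit Arguments.
Unset Strict Implicit.
Unset Printing Implicit Defensive.

Import Order.TTheory GRing.Theory Num.Theory.
Import numFieldNormedType.Exports.

Local Open Scope classical_set_scope.
Local Open Scope ring_scope.

(** * First touching times and one-variable calculus *)

(** The set where [F] is nonnegative is closed in a compact set, so the time coordinate attains its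
    minimum there. Before that time [F] is negative, and continuity from the left carries [F <= 0]
    up to the time itself. *)
Lemma first_touch (K : realType) (X : topologicalType) (A : set X) (a b : K)
    (F : X * K -> K) :
  compact A -> {within A `*` `[a, b], continuous F} ->
  (forall x, A x -> F (x, a) < 0) ->
  (exists x t, [/\ A x, a <= t <= b & 0 <= F (x, t)]) ->
  exists x t, [/\ A x, a < t <= b, F (x, t) = 0 &
    forall y s, A y -> a <= s <= t -> F (y, s) <= 0].
Proof.
move=> cA cF Fa [x0 [t0 [Ax0 t0ab F0]]].
have cAB : compact (A `*` `[a, b]) by apply: compact_setX => //; exact: segment_compact.
have /closed_subspaceP[V cV VE] :
    closed ((F : subspace (A `*` `[a, b]) -> K) @^-1` [set y | 0 <= y]).
  apply: closed_comp => [x _|]; [exact: cF|exact: closed_ge].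
pose S := (A `*` `[a, b]) `&` V.
have SE z : S z <-> (A `*` `[a, b]) z /\ 0 <= F z.
  rewrite /S setIC VE; split=> -[] //.
have cS : compact S by exact: compact_closedI.
have S0 : S !=set0.
  by exists (x0, t0); apply/SE; split => //; split => //=; rewrite in_itv.
have [|[x t] /set_mem/SE[[/= Ax]]] := @compact_EVT_min _ K snd S S0 cS.
  by apply: continuous_subspaceT => z; exact: cvg_snd.
rewrite in_itv /= => /andP[at_ tb] Fxt mint.
have neg y s : A y -> a <= s < t -> F (y, s) < 0.
  move=> Ay /andP[as_ st]; rewrite ltNge; apply/negP => Fys.
  have /mint /= : (y, s) \in S.
    by apply/mem_set/SE; split => //; split => //=; rewrite in_itv /= as_ (le_trans (ltW st)).
  by rewrite leNgt st.
have {}at_ : a < t.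
  rewrite lt_neqAle at_ andbT; apply/eqP => ta; subst t.
  by have := Fa x Ax; rewrite ltNge Fxt.
have le0 y s : A y -> a <= s <= t -> F (y, s) <= 0.
  move=> Ay /andP[as_]; rewrite le_eqVlt => /orP[/eqP ->|st]; last first.
    by apply/ltW/neg => //; rewrite as_ st.
  (* The continuity is joint and relative to [A] times [[a, b]]; with [y] frozen it yields a limit
     from the left at [t]. *)
  have cFt : F (y, r) @[r --> t^'-] --> F (y, t).
    have := (subspace_continuousP _ F).1 cF (y, t).
    have ABt : (A `*` `[a, b]) (y, t).
      by split => //=; rewrite in_itv /= (ltW at_) tb.
    move=> /(_ ABt) H; apply: cvg_trans H => U /=; rewrite !nbhs_simpl /within /=.
    move=> [[P Q] /= [Py Qt] PQ].
    near=> r; apply: (PQ (y, r)); first split => /=.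
    - exact: nbhs_singleton Py.
    - near: r; exact: cvg_within Qt.
    - split => //=; rewrite in_itv /=; apply/andP; split.
        by near: r; apply: nbhs_left_ge.
      by apply: (@le_trans _ _ t) => //; near: r; exact: nbhs_left_le.
  apply: (cvgr_to_le cFt).
  near=> r; apply/ltW/neg => //; apply/andP; split.
    by near: r; apply: nbhs_left_ge.
  by near: r; exact: nbhs_left_lt.
exists x, t; split => //; first by rewrite at_ tb.
by apply/le_anti; rewrite Fxt andbT; apply: le0; rewrite // lexx andbT ltW.
Unshelve. all: by end_near.
Qed.

Lemma is_derive_remainder (K : realType) (g : K -> K) (a dg e : K) :
  is_derive a 1 g dg -> 0 < e ->
  exists2 d : K, 0 < d &
    forall h, `|h| < d -> `|g (a + h) - g a - h * dg| <= e * `|h|.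
Proof.
move=> [ga <-] e0.
move/cvgrPdist_le : (ga) => /(_ e e0).
rewrite near_withinE => /nbhs_norm0P[d d0 H]; exists d => // h hd.
have [->|h0] := eqVneq h 0; first by rewrite addr0 subrr mul0r subrr normr0 mulr0.
move: (H h hd h0); rewrite -/(derive _ _ _) /GRing.scale /= mulr1.
rewrite [h + a]addrC => {}H.
have -> : g (a + h) - g a - h * 'D_1 g a =
    - h * ('D_1 g a - h^-1 * (g (a + h) - g a)) by field.
by rewrite normrM normrN mulrC ler_pM2r ?normr_gt0.
Qed.

(** If [df] were negative, the remainder bound with [e = - df / 2] would give [f (t - h) > f t] for
    small [h > 0]. A first touching time only provides information on the past, hence the one-sided
    form. *)
Lemma is_derive_ge0_left (K : realType) (f : K -> K) (a t df : K) :
  is_derive t 1 f df -> a < t -> (forall s, a <= s <= t -> f s <= f t) ->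
  0 <= df.
Proof.
move=> fdf at_ ft; rewrite leNgt; apply/negP => df0.
have [|d d0 H] := is_derive_remainder (e := - df / 2) fdf; first lra.
have [h [h0 ha hd]] : exists h : K, [/\ 0 < h, h <= t - a & h <= d / 2].
  exists (Num.min (t - a) (d / 2)).
  by rewrite lt_min subr_gt0 at_ divr_gt0 // !ge_min !lexx orbT.
have hd' : h < d by lra.
have := H (- h); rewrite normrN gtr0_norm // => /(_ hd').
have : f (t - h) <= f t by apply: ft; apply/andP; split; lra.
rewrite ler_norml => ? /andP[? _]; nra.
Qed.

(** The mean value theorem is applied once, to [g s + g (- s) - g2 * s ^+ 2]. Its derivative is
    small compared with [s] because [g1] is derivable at 0, so the derivative of [g1] at that single
    point suffices. *)
Lemma second_difference_cvg (K : realType) (g g1 : K -> K) (g2 r : K) :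
  0 < r -> (forall s : K, `|s| < r -> is_derive s 1 g (g1 s)) ->
  is_derive (0 : K) 1 g1 g2 ->
  (g h + g (- h) - 2 * g 0) / h ^+ 2 @[h --> 0^'+] --> g2.
Proof.
move=> r0 gg1 dg1; apply/cvgrPdist_le => e e0.
have [|d d0 H] := is_derive_remainder (e := e / 2) dg1; first lra.
near=> h.
have h0 : 0 < h by [].
have hr : h < r by near: h; exact: nbhs_right_lt.
have hd : h < d by near: h; exact: nbhs_right_lt.
pose psi s := g s + g (- s) - g2 * s ^+ 2.
have dpsi s : s \in `[0, h] -> is_derive s 1 psi (g1 s - g1 (- s) - g2 * (2 * s)).
  rewrite in_itv /= => /andP[s0 sh].
  have D1 : is_derive s 1 g (g1 s) by apply: gg1; rewrite /= ger0_norm; lra.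
  have D2 : is_derive (- s) 1 g (g1 (- s)).
    by apply: gg1; rewrite /= normrN ger0_norm; lra.
  have D3 : is_derive s 1 (g \o -%R) (- g1 (- s)).
    by apply: (is_derive_eq (is_derive1_comp _ _)); rewrite mulrN1.
  have D4 := is_deriveB (is_deriveD D1 D3) (is_deriveZ g2 (is_deriveX 2 (is_derive_id s 1))).
  by apply: (is_derive_eq D4); rewrite /GRing.scale /=; ring.
have [x xh] := MVT_segment (ltW h0)
  (fun x xh => dpsi x (subset_itv_oo_cc xh))
  (derivable_within_continuous (fun x xh => @ex_derive _ _ _ _ _ _ _ (dpsi x xh))).
rewrite {1}/psi /psi => E.
move: xh; rewrite in_itv /= => /andP[x0 xh].
have := H x; rewrite ger0_norm // => /(_ ltac:(lra)).
have := H (- x); rewrite normrN ger0_norm // => /(_ ltac:(lra)).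
rewrite !add0r !ler_norml => /andP[A1 A2] /andP[A3 A4].
have -> : g2 - (g h + g (- h) - 2 * g 0) / h ^+ 2 =
    - (g1 x - g1 (- x) - g2 * (2 * x)) / h.
  have -> : g h + g (- h) - 2 * g 0 = g2 * h ^+ 2 + (g1 x - g1 (- x) - g2 * (2 * x)) * h.
    by move: E; rewrite subr0 oppr0; lra.
  by field; exact: lt0r_neq0.
by apply/andP; split; rewrite ?ler_pdivlMr ?ler_pdivrMr //; nra.
Unshelve. all: by end_near.
Qed.

(** * Euclidean balls *)

Section EuclideanSpace.
Context {K : realType} {n : nat}.
Implicit Types (x y d : 'rV[K]_n) (h r R : K).

(** The squared Euclidean norm is polynomial in the coordinates, so norm comparisons and barriers
    are written with it and square roots are avoided. *)
Definition sqn x : K := \sum_(i < n) x 0 i ^+ 2.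

Definition dotp x y : K := \sum_(i < n) x 0 i * y 0 i.

Definition e_ (i : 'I_n) : 'rV[K]_n := delta_mx 0 i.

Lemma sqn_ge0 x : 0 <= sqn x.
Proof. by apply: sumr_ge0 => i _; exact: sqr_ge0. Qed.

Lemma eballP R x : 0 < R -> eball R x <-> sqn x < R ^+ 2.
Proof.
move=> R0; rewrite /eball /enorm /= -/(sqn x); split => [H|H].
  by rewrite -(sqr_sqrtr (sqn_ge0 x)) ltr_pXn2r // nnegrE ?sqrtr_ge0 // ltW.
by rewrite -(gtr0_norm R0) -sqrtr_sqr ltr_sqrt // exprn_gt0.
Qed.

Lemma cballP R x : 0 < R -> cball R x <-> sqn x <= R ^+ 2.
Proof.
move=> R0; rewrite /cball /enorm /= -/(sqn x); split => [H|H].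
  by rewrite -(sqr_sqrtr (sqn_ge0 x)) ler_pXn2r // nnegrE ?sqrtr_ge0 // ltW.
by rewrite -(gtr0_norm R0) -sqrtr_sqr ler_wsqrtr.
Qed.

Lemma esphereP R x : 0 < R -> esphere R x <-> sqn x = R ^+ 2.
Proof.
move=> R0; rewrite /esphere /enorm /= -/(sqn x); split => [<-|->].
  by rewrite sqr_sqrtr // sqn_ge0.
by rewrite sqrtr_sqr gtr0_norm.
Qed.

Lemma sqnDZ x d h :
  sqn (x + h *: d) = sqn x + 2 * h * dotp x d + h ^+ 2 * sqn d.
Proof.
rewrite /sqn /dotp !mulr_sumr -!big_split /=; apply: eq_bigr => i _.
by rewrite !mxE; ring.
Qed.

Lemma sqnBZ x d h :
  sqn (x - h *: d) = sqn x - 2 * h * dotp x d + h ^+ 2 * sqn d.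
Proof. by rewrite -scaleNr sqnDZ; ring. Qed.

Lemma sqnZ x h : sqn (h *: x) = h ^+ 2 * sqn x.
Proof. by rewrite /sqn mulr_sumr; apply: eq_bigr => i _; rewrite mxE exprMn. Qed.

Lemma sqn_delta (i : 'I_n) : sqn (e_ i) = 1.
Proof.
rewrite /sqn (bigD1 i) //= big1 ?mxE ?eqxx /= ?expr1n ?addr0 // => j ji.
by rewrite mxE (negbTE ji) andbF expr0n.
Qed.

Lemma dotp_delta x (i : 'I_n) : dotp x (e_ i) = x 0 i.
Proof.
rewrite /dotp (bigD1 i) //= big1 ?mxE ?eqxx ?addr0 ?mulr1 // => j ji.
by rewrite mxE (negbTE ji) andbF mulr0.
Qed.

Lemma sqn_continuous : continuous sqn.
Proof.
by apply: continuous_big => [|i _ x]; [exact: add_continuous|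
  exact: (continuous_comp (@coord_continuous _ _ _ _ _ _) (@exprn_continuous _ 2 _))].
Qed.

Lemma eball_open R : 0 < R -> open (@eball K n R).
Proof.
move=> R0; have -> : eball R = sqn @^-1` [set s | s < R ^+ 2].
  by apply/seteqP; split => x /eballP; apply.
by apply: open_comp; [move=> x _; exact: sqn_continuous|exact: open_lt].
Qed.

Lemma eball_line R x : 0 < R -> eball R x ->
  exists2 r, 0 < r & forall y, `|y - x| < r -> eball R y.
Proof.
move=> R0 xR; have := open_nbhs_nbhs (conj (eball_open R0) xR).
move=> /nbhs_normP[r r0 H]; exists r => // y yx; apply: H.
by rewrite /ball_ /= distrC.
Qed.

Lemma cball_compact R : 0 < R -> compact (@cball K n R).
Proof.
move=> R0; apply: bounded_closed_compact.
  exists R; split; first exact: gtr0_real.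
  move=> M RM x /(cballP x R0) xR /=.
  rewrite [leLHS]/Num.norm /= mx_normrE; apply/bigmax_leP; split.
    exact: ltW (lt_trans R0 RM).
  move=> [i j] _ /=; rewrite ord1 (le_trans _ (ltW RM)) //.
  rewrite -(@ler_pXn2r _ 2) ?nnegrE ?(ltW R0) // real_normK ?num_real //.
  apply: le_trans xR; rewrite /sqn (bigD1 j) //= lerDl.
  by apply: sumr_ge0 => k _; exact: sqr_ge0.
have -> : cball R = sqn @^-1` [set s | s <= R ^+ 2].
  by apply/seteqP; split => x /cballP; apply.
by apply: closed_comp; [move=> x _; exact: sqn_continuous|exact: (@closed_le K (R ^+ 2))].
Qed.

End EuclideanSpace.

(** * Second derivatives along arbitrary directions *)

(** Converse of [is_derive_remainder]; it turns the chain rule below into an estimate. *)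
Lemma remainder_is_derive (K : realType) (g : K -> K) (a dg : K) :
  (forall e : K, 0 < e -> exists2 d : K, 0 < d &
    forall h, `|h| < d -> `|g (a + h) - g a - h * dg| <= e * `|h|) ->
  is_derive a 1 g dg.
Proof.
move=> H.
suff C : h^-1 *: ((g \o shift a) (h *: 1) - g a) @[h --> 0^'] --> dg.
  by split; [apply/cvg_ex; exists dg|exact: cvg_lim].
apply/cvgrPdist_le => e e0; rewrite near_withinE.
have [d d0 Hd] := H e e0.
suff N : \forall h \near (0 : K), h != 0 -> `|dg - h^-1 * (g (a + h) - g a)| <= e.
  by apply: filterS N => h /= N /N; rewrite /GRing.scale /= mulr1 [h + a]addrC.
apply/nbhs_norm0P; exists d => // h /Hd {}Hd h0.
have -> : dg - h^-1 * (g (a + h) - g a) = - h^-1 * (g (a + h) - g a - h * dg).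
  by field.
by rewrite normrM normrN normfV mulrC ler_pdivrMr ?normr_gt0.
Qed.

Lemma is_derive_line (K : realType) (n : nat) (f : 'rV[K]_n -> K)
    (y v : 'rV[K]_n) (s df : K) :
  is_derive (y + s *: v) v f df -> is_derive s 1 (fun t => f (y + t *: v)) df.
Proof.
have E : (fun h : K => h^-1 *: (((fun t => f (y + t *: v)) \o shift s) (h *: 1) -
    f (y + s *: v))) =
    (fun h => h^-1 *: ((f \o shift (y + s *: v)) (h *: v) - f (y + s *: v))).
  apply/funext => h /=; congr (_ *: (f _ - _)).
  by rewrite [h *: 1]mulr1 scalerDl addrCA.
by move=> [D1 D2]; split; rewrite /derivable /derive /= E.
Qed.

Section ChainRule.
Context {K : realType} {n : nat}.
Implicit Types (f : 'rV[K]_n -> K) (x y d : 'rV[K]_n).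

Lemma coordinate_MVT f (g : 'rV[K]_n -> K) i y (a : K) :
  (forall s : K, `|s| <= `|a| -> is_derive (y + s *: e_ i) (e_ i) f (g (y + s *: e_ i))) ->
  exists2 c : K, `|c| <= `|a| & f (y + a *: e_ i) - f y = a * g (y + c *: e_ i).
Proof.
move=> H.
have D (s : K) : `|s| <= `|a| ->
    is_derive s 1 (fun t => f (y + t *: e_ i)) (g (y + s *: e_ i)).
  by move=> /H /is_derive_line.
have [a0|a0] := leP 0 a.
  have D' (s : K) : s \in `[0, a] ->
      is_derive s 1 (fun t => f (y + t *: e_ i)) (g (y + s *: e_ i)).
    by rewrite in_itv /= => /andP[s0 sa]; apply: D; rewrite !ger0_norm.
  have [c] := MVT_segment a0 (fun s sa => D' s (subset_itv_oo_cc sa))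
    (derivable_within_continuous (fun s sa => @ex_derive _ _ _ _ _ _ _ (D' s sa))).
  rewrite in_itv /= => /andP[c0 ca]; rewrite scale0r addr0 subr0 mulrC => E.
  by exists c => //; rewrite !ger0_norm.
have D' (s : K) : s \in `[a, 0] ->
    is_derive s 1 (fun t => f (y + t *: e_ i)) (g (y + s *: e_ i)).
  by rewrite in_itv /= => /andP[sa s0]; apply: D; rewrite !ler0_norm ?lerN2 // ltW.
have [c] := MVT_segment (ltW a0) (fun s sa => D' s (subset_itv_oo_cc sa))
  (derivable_within_continuous (fun s sa => @ex_derive _ _ _ _ _ _ _ (D' s sa))).
rewrite in_itv /= => /andP[ca c0]; rewrite scale0r addr0 sub0r mulrN => E.
exists c; first by rewrite !ler0_norm ?lerN2 // ltW.
by rewrite -[LHS]opprB E opprK mulrC.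
Qed.

(** Corners of the staircase path from 0 to [d] that moves one coordinate at a time. *)
Definition trunc_row d (k : nat) : 'rV[K]_n := \row_j (if (j < k)%N then d 0 j else 0).

Lemma trunc_rowS d (i : 'I_n) : trunc_row d i.+1 = trunc_row d i + d 0 i *: e_ i.
Proof.
apply/rowP => j; rewrite !mxE /= ltnS leq_eqVlt -val_eqE /=.
by case: (ltngtP j i) => [ji|ji|/val_inj ->]; rewrite ?mulr0 ?addr0 ?mulr1 ?add0r.
Qed.

Lemma normr_row_le d (M : K) : 0 <= M -> (forall j, `|d 0 j| <= M) -> `|d| <= M.
Proof.
move=> M0 H; rewrite [leLHS]/Num.norm /= mx_normrE; apply/bigmax_leP; split => //.
by move=> [i j] _ /=; rewrite ord1.
Qed.

Lemma coord_le_normr d j : `|d 0 j| <= `|d|.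
Proof.
by rewrite [leRHS]/Num.norm /= mx_normrE; apply/bigmax_geP; right; exists (0, j).
Qed.

(** The increment is telescoped along the staircase of [trunc_row]. Each step is a one-variable mean
    value theorem, and continuity of the partial derivatives at [x] replaces the intermediate points
    by [x]. *)
Lemma is_derive_along f (g : 'I_n -> 'rV[K]_n -> K) x d (r : K) : 0 < r ->
  (forall y, `|y - x| < r -> forall i, is_derive y (e_ i) f (g i y)) ->
  (forall i, {for x, continuous (g i)}) ->
  is_derive (0 : K) 1 (fun s => f (x + s *: d)) (\sum_i d 0 i * g i x).
Proof.
move=> r0 fg cg; apply: remainder_is_derive => e e0.
pose D := \sum_i `|d 0 i|.
have D0 : 0 <= D by apply: sumr_ge0.
have e'0 : 0 < e / (D + 1) by rewrite divr_gt0 // ltr_pwDr.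
have [r1 r10 H1] : exists2 r1 : K, 0 < r1 & forall y, `|y - x| < r1 ->
    forall i, `|g i y - g i x| <= e / (D + 1).
  have : \forall y \near x, forall i, `|g i y - g i x| <= e / (D + 1).
    suff H i : \forall y \near x, `|g i y - g i x| <= e / (D + 1).
      exact: (filter_forall _ H).
    have /cvgrPdist_le /(_ _ e'0) := cg i.
    by apply: filterS => y; rewrite distrC.
  move=> /nbhs_normP[r1 r10 H]; exists r1 => // y yx; apply: H.
  by rewrite /ball_ /= distrC.
have d10 : 0 < `|d| + 1 by rewrite ltr_pwDr.
exists (Num.min r r1 / (`|d| + 1)).
  by rewrite divr_gt0 // lt_min r0.
move=> h; rewrite ltr_pdivlMr // lt_min => /andP[hr hr1].
(* Every point used on the staircase differs from [x] coordinatewise by at most the entries of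
   [h *: d], hence by at most [|h| |d|] in the sup norm. *)
have close k (c : K) (i : 'I_n) : (k <= i)%N -> `|c| <= `|h * d 0 i| ->
    `|x + h *: trunc_row d k + c *: e_ i - x| <= `|h| * `|d|.
  move=> ki ch; rewrite -(addrA x) (addrC x) addrK; apply: normr_row_le.
    by rewrite mulr_ge0.
  move=> j; rewrite !mxE /=; case: ltnP => jk.
    have /negbTE -> : j != i by rewrite -val_eqE /= neq_ltn (leq_trans jk ki).
    by rewrite mulr0 addr0 normrM ler_wpM2l // coord_le_normr.
  rewrite mulr0 add0r; case: eqP => [ji|_]; last by rewrite mulr0 normr0 mulr_ge0.
  by rewrite mulr1 (le_trans ch) // normrM ler_wpM2l // coord_le_normr.
have lt_hd (rr : K) : `|h| * (`|d| + 1) < rr -> `|h| * `|d| < rr.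
  by apply: le_lt_trans; rewrite ler_wpM2l // lerDl.
pose F k := f (x + h *: trunc_row d k).
have step (i : 'I_n) : `|F i.+1 - F i - h * (d 0 i * g i x)| <=
    `|h| * (`|d 0 i| * (e / (D + 1))).
  have [s sh|c ch] := @coordinate_MVT f (g i) i (x + h *: trunc_row d i) (h * d 0 i).
    by apply: fg; apply: le_lt_trans (close _ _ _ (leqnn _) sh) _; exact: lt_hd.
  rewrite /F trunc_rowS scalerDr scalerA addrA => ->.
  rewrite mulrA -mulrBr !normrM -mulrA !ler_wpM2l //.
  by apply: H1; apply: le_lt_trans (close _ _ _ (leqnn _) ch) _; exact: lt_hd.
have -> : f (x + (0 + h) *: d) - f (x + 0 *: d) = \sum_(i < n) (F i.+1 - F i).
  rewrite -(big_mkord xpredT (fun i => F i.+1 - F i)) telescope_sumr // /F.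
  congr (f _ - f _); rewrite ?add0r ?scale0r; congr (_ + _).
    by congr (_ *: _); apply/rowP => j; rewrite mxE ltn_ord.
  by rewrite (_ : trunc_row d 0 = 0) ?scaler0 //; apply/rowP => j; rewrite !mxE.
rewrite mulr_sumr -sumrB (le_trans (ler_norm_sum _ _ _)) //.
apply: (le_trans (ler_sum _ (fun i _ => step i))).
rewrite -mulr_sumr -mulr_suml -/D mulrC ler_wpM2r // mulrA ler_pdivrMr; last lra.
by rewrite mulrC ler_wpM2l ?(ltW e0) // lerDl.
Unshelve. all: by end_near.
Qed.

End ChainRule.

(* Second derivatives enter the comparison arguments only as limits of these
   quotients: a maximum makes them nonpositive without further regularity. *)
Definition sdiff2 (K : realType) (n : nat) (f : 'rV[K]_n -> K) (x d : 'rV[K]_n) (h : K) : K :=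
  (f (x + h *: d) + f (x - h *: d) - 2 * f x) / h ^+ 2.

(** Orthonormality is stated on the columns of the square matrix with rows [d i]; this is the form
    in which sums over the frame collapse to traces. *)
Definition orthonormal_frame (K : realType) (n : nat) (d : 'I_n -> 'rV[K]_n) :=
  forall k l, \sum_i d i 0 k * d i 0 l = (k == l)%:R.

Lemma cvg_to_within {T U : Type} (F : set_system T) {FF : Filter F}
    (G : set_system U) (f : T -> U) (D : set U) :
  f @ F --> G -> (\forall x \near F, D (f x)) -> f @ F --> within D G.
Proof. by move=> fG fD S GS; apply: filterS2 fD (fG _ GS) => x Dx; apply. Qed.

Section SecondDifferences.
Context {K : realType} {n : nat}.
Implicit Types (f : 'rV[K]_n -> K) (x y d : 'rV[K]_n).

Lemma sdiff2_cvg f (R : K) x d : 0 < R -> eball R x ->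
  (forall y i, eball R y -> derivable f y (delta_mx 0 i)) ->
  (forall y i, eball R y -> {for y, continuous (partial i f)}) ->
  (forall y i j, eball R y -> derivable (partial i f) y (delta_mx 0 j)) ->
  (forall y i j, eball R y -> {for y, continuous (partial j (partial i f))}) ->
  sdiff2 f x d h @[h --> 0^'+] -->
    \sum_i d 0 i * \sum_j d 0 j * partial j (partial i f) x.
Proof.
move=> R0 xR df cf ddf ccf.
have [r r0 xr] := eball_line R0 xR.
have d10 : 0 < `|d| + 1 by rewrite ltr_pwDr.
have line (s : K) : `|s| < r / (`|d| + 1) -> eball R (x + s *: d).
  rewrite ltr_pdivlMr // => sr; apply: xr; rewrite addrC addKr normrZ.
  by apply: le_lt_trans sr; rewrite ler_wpM2l // lerDl.
pose g s := f (x + s *: d); pose g1 (s : K) := \sum_i d 0 i * partial i f (x + s *: d).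
have gg1 (s : K) : `|s| < r / (`|d| + 1) -> is_derive s 1 g (g1 s).
  move=> /line sR; have [r' r'0 yr] := eball_line R0 sR.
  have := @is_derive_along _ _ f (fun i => partial i f) (x + s *: d) d r' r'0.
  move=> /(_ (fun y Hy i => derivableP (df y i (yr y Hy))) (fun i => cf _ i sR)) H.
  (* [is_derive_along] differentiates at parameter 0 only, so the line is recentred at
     [x + s *: d]. *)
  have -> : g = (fun t => f ((x + s *: d) + t *: d)) \o (fun t => t - s).
    by apply/funext => t /=; rewrite /g -addrA -scalerDl [s + _]addrC subrK.
  apply: (is_derive_eq (@is_derive1_comp _ _ _ s (g1 s) 1 _ _)); last by rewrite mulr1.
  - by rewrite subrr.
  - by apply: is_derive_eq; rewrite subr0.
have dg1 : is_derive (0 : K) 1 g1 (\sum_i d 0 i * \sum_j d 0 j * partial j (partial i f) x).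
  have -> : g1 = \sum_i (fun s => d 0 i *: (partial i f (x + s *: d) : K)).
    by apply/funext => s; rewrite /g1 fct_sumE.
  apply: is_derive_sum => i; apply: is_deriveZ.
  exact: (@is_derive_along _ _ (partial i f) (fun j => partial j (partial i f)) x d r r0
     (fun y Hy j => derivableP (ddf y i j (xr y Hy))) (fun j => ccf _ i j xR)).
have rd0 : 0 < r / (`|d| + 1) by rewrite divr_gt0.
have := second_difference_cvg rd0 gg1 dg1.
rewrite /g scale0r addr0; apply: cvg_trans; apply: near_eq_cvg.
by near=> h; rewrite /sdiff2 scaleNr.
Unshelve. all: by end_near.
Qed.

(** Invariance of the trace of the Hessian: summing over the frame first turns the products of
    coefficients into a Kronecker delta. *)
Lemma sum_sdiff2_laplacian f x (d : 'I_n -> 'rV[K]_n) : orthonormal_frame d ->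
  \sum_m \sum_i d m 0 i * \sum_j d m 0 j * partial j (partial i f) x =
  laplacian f x.
Proof.
move=> dd; rewrite exchange_big /=; apply: eq_bigr => i _.
under eq_bigr do rewrite mulr_sumr.
rewrite exchange_big (bigD1 i) //= [X in _ + X]big1 => [|j ji].
  by under eq_bigr do rewrite mulrA; rewrite -mulr_suml dd eqxx mul1r addr0.
by under eq_bigr do rewrite mulrA; rewrite -mulr_suml dd eq_sym (negbTE ji) mul0r.
Qed.

(** The frame is left free because the doubling argument needs the coordinate frame at one point and
    a reflected frame at the other. *)
Lemma heat_second_differences (R T : K) (u : 'rV[K]_n -> K -> K) x (t : K)
    (d : 'I_n -> 'rV[K]_n) :
  0 < R -> classical_regularity R T u ->
  (forall x (t : K), eball R x -> 0 < t < T -> 'D_1 (u x) t = laplacian (u^~ t) x) ->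
  eball R x -> 0 < t < T -> orthonormal_frame d ->
  exists2 H : 'I_n -> K,
    forall i, sdiff2 (u^~ t) x (d i) h @[h --> 0^'+] --> H i &
    \sum_i H i = 'D_1 (u x) t.
Proof.
move=> R0 ru heat xR tT dd.
have slice (F : 'rV[K]_n -> K -> K) y : eball R y ->
    {within eball R `*` `]0, T[, continuous (fun z : 'rV[K]_n * K => F z.1 z.2)} ->
    {for y, continuous (F^~ t)}.
  move=> yR; have Ayt : (eball R `*` `]0, T[) (y, t) by split => //=; rewrite in_itv.
  move=> /subspace_continuousP /(_ _ Ayt) H.
  apply: (@cvg_comp _ _ _ (fun z => (z, t)) (fun z => F z.1 z.2) (nbhs y)
    (within (eball R `*` `]0, T[) (nbhs (y, t))) _ _ H).
  apply: cvg_to_within.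
    exact: (@cvg_pair _ _ _ (nbhs y) (nbhs y) (nbhs t) _ _ _ id (fun=> t) cvg_id (cvg_cst _)).
  have : nbhs y (eball R) by apply: open_nbhs_nbhs; split => //; exact: eball_open.
  by apply: filterS => z zR; split => //=; rewrite in_itv.
exists (fun m => \sum_i d m 0 i * \sum_j d m 0 j * partial j (partial i (u^~ t)) x).
  move=> m; apply: (sdiff2_cvg (R := R)) => //.
  - by move=> y i yR; exact: (cr_derx ru).
  - move=> y i yR.
    exact: (slice (fun y t => partial i (u^~ t) y) y yR (@cr_derx_cont _ _ _ _ _ ru i)).
  - by move=> y i j yR; exact: (cr_derxx ru).
  - move=> y i j yR.
    exact: (slice (fun y t => partial j (partial i (u^~ t)) y) y yR
      (@cr_derxx_cont _ _ _ _ _ ru i j)).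
by rewrite (sum_sdiff2_laplacian _ _ dd) heat.
Qed.

End SecondDifferences.

(** * Touching a solution of the heat equation *)

Section Quadratic.
Context {K : realType} {n : nat}.
Implicit Types (x d : 'rV[K]_n) (a b c R : K).

Lemma sum_sqn_frame (d : 'I_n -> 'rV[K]_n) : orthonormal_frame d ->
  \sum_i sqn (d i) = n%:R.
Proof.
move=> dd; rewrite exchange_big /=.
under eq_bigr do under eq_bigr do rewrite expr2.
by under eq_bigr do rewrite dd eqxx; rewrite sumr_const card_ord.
Qed.

Lemma sum_dotp_frame (d : 'I_n -> 'rV[K]_n) x : orthonormal_frame d ->
  \sum_i dotp x (d i) ^+ 2 = sqn x.
Proof.
move=> dd; rewrite /sqn.
have E i : dotp x (d i) ^+ 2 = \sum_k \sum_l x 0 k * x 0 l * (d i 0 k * d i 0 l).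
  rewrite expr2 /dotp mulr_suml; apply: eq_bigr => k _; rewrite mulr_sumr.
  by apply: eq_bigr => l _; ring.
under eq_bigr do rewrite E.
rewrite exchange_big /=; apply: eq_bigr => k _.
rewrite exchange_big (bigD1 k) //= [X in _ + X]big1 => [|l lk].
  by rewrite -mulr_sumr dd eqxx mulr1 addr0 expr2.
by rewrite -mulr_sumr dd eq_sym (negbTE lk) mulr0.
Qed.

Lemma orthonormal_frame_delta : orthonormal_frame (@e_ K n).
Proof.
move=> k l; rewrite (bigD1 k) //= big1 => [|i ik]; rewrite !mxE ?eqxx /=.
  by rewrite addr0 mul1r eq_sym.
by rewrite eq_sym (negbTE ik) mul0r.
Qed.

(** Expanding in [sqn x - R ^+ 2] separates the roles of the coefficients on the sphere of radius
    [R]: the value there is [a], the normal derivative is [2 * R * b], and [c] affects neither. *)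
Definition quad a b c R x : K :=
  a + b * (sqn x - R ^+ 2) + c * (sqn x - R ^+ 2) ^+ 2.

Definition lap_quad b c R x : K :=
  2 * n%:R * b + c * (4 * n%:R * (sqn x - R ^+ 2) + 8 * sqn x).

Lemma sdiff2_quad a b c R x d :
  sdiff2 (quad a b c R) x d h @[h --> 0^'+] -->
    2 * b * sqn d + c * (4 * (sqn x - R ^+ 2) * sqn d + 8 * dotp x d ^+ 2).
Proof.
set l := (X in _ --> X).
(* The quotient equals the limit plus an explicit multiple of [h ^+ 2]; the limit is rewritten as
   the value of this expression at [h = 0]. *)
have -> : l = l + 2 * c * sqn d ^+ 2 * (0 * 0) by rewrite !mulr0 addr0.
have : l + 2 * c * sqn d ^+ 2 * (h * h) @[h --> 0^'+] -->
    l + 2 * c * sqn d ^+ 2 * (0 * 0).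
  have C0 : (h : K) @[h --> (0:K)^'+] --> (0:K).
    exact: cvg_within.
  by apply: cvgD; [exact: cvg_cst|apply: cvgM; [exact: cvg_cst|exact: cvgM]].
apply: cvg_trans; apply: near_eq_cvg; near=> h.
have h0 : h != 0 by apply: lt0r_neq0; near: h; exact: nbhs_right_gt.
rewrite /sdiff2 /quad sqnBZ sqnDZ /l; field.
by [].
Unshelve. all: by end_near.
Qed.

Lemma sum_sdiff2_quad b c R x (d : 'I_n -> 'rV[K]_n) : orthonormal_frame d ->
  \sum_i (2 * b * sqn (d i) +
     c * (4 * (sqn x - R ^+ 2) * sqn (d i) + 8 * dotp x (d i) ^+ 2)) =
  lap_quad b c R x.
Proof.
move=> dd; rewrite big_split /= -!mulr_sumr big_split /= -!mulr_sumr.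
by rewrite (sum_sqn_frame dd) (sum_dotp_frame _ dd) /lap_quad; ring.
Qed.

Lemma quad_normal_derivative a b c R x : 0 < R -> esphere R x ->
  has_normal_derivative (quad a b c R) x (2 * R * b).
Proof.
move=> R0 xR; rewrite /has_normal_derivative.
have xs : sqn x = R ^+ 2 by apply/esphereP.
have nx : enorm x = R by [].
set l := 2 * R * b.
have -> : l = l - 0 * (b + c * (0 - 2 * R) ^+ 2) by rewrite mul0r subr0.
have : l - h * (b + c * (h - 2 * R) ^+ 2) @[h --> 0^'+] -->
    l - 0 * (b + c * (0 - 2 * R) ^+ 2).
  have C0 : (h : K) @[h --> (0:K)^'+] --> (0:K) by exact: cvg_within.
  apply: cvgB; first exact: cvg_cst.
  apply: cvgM => //; apply: cvgD; first exact: cvg_cst.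
  apply: cvgM; first exact: cvg_cst.
  have C1 : (h - 2 * R) @[h --> (0:K)^'+] --> 0 - 2 * R by apply: cvgB => //; exact: cvg_cst.
  by rewrite !expr2; exact: (cvgM C1 C1).
apply: cvg_trans; apply: near_eq_cvg; near=> h.
have h0 : h != 0 by apply: lt0r_neq0; near: h; exact: nbhs_right_gt.
have dx : dotp x (outward_normal x) = R.
  rewrite /dotp /outward_normal nx.
  transitivity (R^-1 * sqn x); last by rewrite xs expr2 mulKf // gt_eqF.
  by rewrite mulr_sumr; apply: eq_bigr => i _; rewrite !mxE; ring.
have sn : sqn (outward_normal x) = 1.
  by rewrite /outward_normal sqnZ nx xs -exprMn mulVf ?expr1n // gt_eqF.
rewrite /quad sqnBZ dx sn xs /l; field.
by [].
Unshelve. all: by end_near.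
Qed.

End Quadratic.

Section Touching.
Context {K : realType} {n : nat}.
Variables (R T : K) (u : 'rV[K]_n -> K -> K).
Hypothesis R0 : 0 < R.
Hypothesis ru : classical_regularity R T u.
Hypothesis heat : forall x (t : K), eball R x -> 0 < t < T ->
  'D_1 (u x) t = laplacian (u^~ t) x.

Lemma line_near (x d : 'rV[K]_n) (r : K) : 0 < r ->
  \forall h \near (0 : K)^'+, `|x + h *: d - x| < r /\ `|x - h *: d - x| < r.
Proof.
move=> r0; near=> h.
have h0 : 0 < h by near: h; exact: nbhs_right_gt.
have hd : h < r / (`|d| + 1) by near: h; apply: nbhs_right_lt; rewrite divr_gt0 // ltr_pwDr.
have : h * `|d| < r.
  apply: (@le_lt_trans _ _ (h * (`|d| + 1))); first by rewrite ler_wpM2l ?(ltW h0) // lerDl.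
  by rewrite -ltr_pdivlMr // ltr_pwDr.
by rewrite ![x + _]addrC !addrK normrN normrZ gtr0_norm.
Unshelve. all: by end_near.
Qed.

(* [sg = 1] for a barrier below [u], [sg = -1] for a barrier above [u]. *)
Lemma touch_laplacian (sg r t : K) (x : 'rV[K]_n) (w : 'rV[K]_n -> K) (H : 'I_n -> K) :
  eball R x -> 0 < t < T ->
  (forall i, sdiff2 w x (e_ i) h @[h --> 0^'+] --> H i) -> 0 < r ->
  (forall y, `|y - x| < r -> sg * (w y - u y t) <= sg * (w x - u x t)) ->
  sg * \sum_i H i <= sg * 'D_1 (u x) t.
Proof.
move=> xR tT wH r0 touch.
have [Hu uH <-] := heat_second_differences R0 ru heat xR tT (@orthonormal_frame_delta K n).
rewrite !mulr_sumr; apply: ler_sum => i _.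
apply: (ler_cvg_to (cvgM (cvg_cst sg) (wH i)) (cvgM (cvg_cst sg) (uH i))).
have := line_near x (e_ i) r0; apply: filterS => h [h1 h2].
rewrite /= /sdiff2 !mulrA ler_wpM2r ?invr_ge0 ?sqr_ge0 //.
have := touch _ h1; have := touch _ h2; lra.
Qed.

(** A local maximum of [sg * (w - u)] in space compares the Laplacians, and a maximum over past
    times compares the time derivatives; the heat equation links the two. *)
Lemma touch_interior (sg r a t dw : K) (x : 'rV[K]_n) (w : 'rV[K]_n -> K -> K)
    (H : 'I_n -> K) :
  eball R x -> 0 < t < T ->
  (forall i, sdiff2 (w^~ t) x (e_ i) h @[h --> 0^'+] --> H i) -> 0 < r ->
  (forall y, `|y - x| < r -> sg * (w y t - u y t) <= sg * (w x t - u x t)) ->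
  is_derive t 1 (w x) dw -> a < t ->
  (forall s, a <= s <= t -> sg * (w x s - u x s) <= sg * (w x t - u x t)) ->
  sg * \sum_i H i <= sg * dw.
Proof.
move=> xR tT wH r0 touch Dw at_ touch'.
apply: (le_trans (touch_laplacian xR tT wH r0 touch)).
have Du := derivableP (cr_dert ru xR tT).
have := is_derive_ge0_left (is_deriveZ sg (is_deriveB Dw Du)) at_ touch'.
by rewrite /GRing.scale /= mulrBr subr_ge0.
Qed.

End Touching.

(** Reduces to [first_touch] for the pointwise maximum of [F] and [G]. *)
Lemma first_touch_pair (K : realType) (X : topologicalType) (A : set X) (a b : K)
    (F G : X * K -> K) :
  compact A -> {within A `*` `[a, b], continuous F} ->
  {within A `*` `[a, b], continuous G} ->
  (forall x, A x -> F (x, a) < 0 /\ G (x, a) < 0) ->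
  (exists x t, [/\ A x, a <= t <= b & 0 <= F (x, t) \/ 0 <= G (x, t)]) ->
  exists x t, [/\ A x, a < t <= b, F (x, t) = 0 \/ G (x, t) = 0 &
    forall y s, A y -> a <= s <= t -> F (y, s) <= 0 /\ G (y, s) <= 0].
Proof.
move=> cA cF cG FGa [x0 [t0 [Ax0 t0ab FG0]]].
have cFG : {within A `*` `[a, b], continuous (F \max G)}.
  by move=> z; apply: continuous_max; [exact: cF|exact: cG].
have [||x [t [Ax tab FG le0]]] := first_touch cA cFG.
- by move=> x /FGa[? ?]; rewrite gt_max; apply/andP.
- by exists x0, t0; split => //; rewrite le_max; apply/orP.
exists x, t; split => //.
  by move: FG; rewrite /= /Order.max; case: ifP => _; [right|left].
by move=> y s Ay /(le0 y s Ay); rewrite ge_max => /andP.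
Qed.

(** * Lower barriers and the blow-up rate *)

Section LowerBarrier.
Context {K : realType} {n : nat}.
Implicit Types (x y : 'rV[K]_n) (u : 'rV[K]_n -> K -> K).

Lemma sqn_inward (R h : K) x : 0 < R -> esphere R x -> 0 <= h <= R ->
  sqn (x - h *: outward_normal x) = (R - h) ^+ 2.
Proof.
move=> R0 xR /andP[h0 hR].
have xs : sqn x = R ^+ 2 by apply/esphereP.
have nx : enorm x = R by [].
have -> : x - h *: outward_normal x = (1 - h / R) *: x.
  by rewrite /outward_normal nx scalerA scalerBl scale1r.
rewrite sqnZ xs -exprMn mulrBl mul1r divfK //; exact: lt0r_neq0.
Qed.

Lemma touch_normal (r l1 l2 : K) (w1 w2 : 'rV[K]_n -> K) x : 0 < r ->
  has_normal_derivative w1 x l1 -> has_normal_derivative w2 x l2 ->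
  (forall h, 0 < h < r -> w1 (x - h *: outward_normal x) -
     w2 (x - h *: outward_normal x) <= w1 x - w2 x) -> l2 <= l1.
Proof.
move=> r0 W1 W2 touch; apply: (ler_cvg_to W2 W1).
near=> h.
have h0 : 0 < h by [].
have hr : h < r by near: h; exact: nbhs_right_lt.
have := touch h; rewrite h0 hr => /(_ isT) {}touch.
rewrite ler_wpM2l ?invr_ge0 ?(ltW h0) //; lra.
Unshelve. all: by end_near.
Qed.

(* For c <= 0 and b nondecreasing, a' < 2nb + 8cR^2 makes
   a(t) + b(t)(|x|^2 - R^2) + c(|x|^2 - R^2)^2 a strict subsolution on the ball. *)
Definition subbarrier (R c t0 t1 : K) (a b : K -> K) : Prop :=
  c <= 0 /\ forall t, t0 <= t <= t1 -> exists a' b' : K,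
    [/\ is_derive t 1 a a', is_derive t 1 b b', 0 <= b' &
        a' < 2 * n%:R * b t + 8 * c * R ^+ 2].

Lemma barrier_is_derive (a b : K -> K) (a' b' c R t : K) x :
  is_derive t 1 a a' -> is_derive t 1 b b' ->
  is_derive t 1 (fun s => quad (a s) (b s) c R x) (a' + b' * (sqn x - R ^+ 2)).
Proof.
move=> Da Db; rewrite /quad.
set k := sqn x - R ^+ 2.
have -> : (fun s => a s + b s * k + c * k ^+ 2) =
    a + (k *: b) + cst (c * k ^+ 2).
  by apply/funext => s; rewrite !fctE /GRing.scale /= [b s * k]mulrC.
by apply: is_derive_eq; rewrite addr0 /GRing.scale /= mulrC.
Qed.

Lemma barrier_continuous (R c t0 t1 : K) (a b : K -> K) (A : set 'rV[K]_n) :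
  subbarrier R c t0 t1 a b ->
  {within A `*` `[t0, t1],
    continuous (fun z : 'rV[K]_n * K => quad (a z.2) (b z.2) c R z.1)}.
Proof.
move=> [_ ab]; apply/subspace_continuousP => -[x t] [/= _].
rewrite in_itv /= => /ab[a' [b' [Da Db _ _]]].
apply: cvg_within_filter; rewrite /quad.
have C (f : K -> K) df : is_derive t 1 f df ->
    f z.2 @[z --> nbhs (x, t)] --> f t.
  move=> Df; apply: (@cvg_comp _ _ _ snd f _ (nbhs t)); first exact: cvg_snd.
  have H : {for t, continuous f}.
    by apply/differentiable_continuous/derivable1_diffP; case: Df.
  exact: H.
have S : sqn z.1 - R ^+ 2 @[z --> nbhs (x, t)] --> sqn x - R ^+ 2.
  apply: cvgB; last exact: cvg_cst.
  by apply: (@cvg_comp _ _ _ fst sqn _ (nbhs x)); [exact: cvg_fst|exact: sqn_continuous].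
rewrite !expr2; apply: cvgD; first apply: cvgD; first exact: C Da.
  by apply: cvgM => //; exact: C Db.
by apply: cvgM; [exact: cvg_cst|exact: (cvgM S S)].
Qed.

(** On the sphere, a barrier touching from below has normal derivative at least that of [u], against
    the flux hypothesis. Inside, the strict subsolution inequality contradicts [touch_interior]. *)
Lemma barrier_no_touch (R T c t0 t1 t : K) (a b : K -> K) u x :
  0 < R -> classical_regularity R T u ->
  (forall x (t : K), eball R x -> 0 < t < T -> 'D_1 (u x) t = laplacian (u^~ t) x) ->
  subbarrier R c t0 t1 a b -> 0 <= t0 -> t1 < T -> t0 < t <= t1 ->
  cball R x -> quad (a t) (b t) c R x = u x t ->
  (forall y s, cball R y -> t0 <= s <= t -> quad (a s) (b s) c R y <= u y s) ->
  (esphere R x -> exists2 l, has_normal_derivative (u^~ t) x l & 2 * R * b t < l) ->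
  False.
Proof.
move=> R0 ru heat [c0 ab] t00 t1T /andP[t0t tt1] xR E le flux.
have tT : 0 < t < T by rewrite (le_lt_trans t00 t0t) (le_lt_trans tt1 t1T).
have [a' [b' [Da Db b'0 a'lt]]] : exists a' b' : K, [/\ is_derive t 1 a a',
    is_derive t 1 b b', 0 <= b' & a' < 2 * n%:R * b t + 8 * c * R ^+ 2].
  by apply: ab; rewrite (ltW t0t) tt1.
have [xS|xB] : esphere R x \/ eball R x.
  have := xR; rewrite /cball /esphere /eball /= le_eqVlt => /orP[/eqP|]; [by left|by right].
- have [l ul] := flux xS; apply/negP; rewrite -leNgt.
  apply: (touch_normal R0 (@quad_normal_derivative _ _ (a t) (b t) c R x R0 xS) ul).
  move=> h /andP[h0 hR].
  have yR : cball R (x - h *: outward_normal x).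
    apply/cballP => //; rewrite (sqn_inward R0 xS); last by rewrite !ltW.
    by rewrite ler_pXn2r // ?nnegrE; lra.
  rewrite E subrr subr_le0; apply: le => //.
  by rewrite (ltW t0t) lexx.
have xs : sqn x <= R ^+ 2 by apply/cballP.
have [r r0 xr] := eball_line R0 xB.
have [] : (1 * lap_quad (b t) c R x <= 1 * (a' + b' * (sqn x - R ^+ 2))).
  rewrite -(sum_sdiff2_quad _ _ _ _ (@orthonormal_frame_delta K n)).
  apply: (touch_interior R0 ru heat (w := fun y s => quad (a s) (b s) c R y)
    xB tT _ r0 _ (barrier_is_derive c R x Da Db) t0t).
  - by move=> i; exact: sdiff2_quad.
  - move=> y yx; rewrite !mul1r E subrr subr_le0; apply: le; first exact/ltW/xr.
    by rewrite (ltW t0t) lexx.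
  - move=> s sI; rewrite !mul1r E subrr subr_le0; exact: le.
(* As [c <= 0] and [|x| <= R], the Laplacian of the barrier is at least [2 n b + 8 c R^2], while
   [b' >= 0] makes its time derivative at most [a']. *)
apply/negP; rewrite -ltNge !mul1r /lap_quad.
have n0 : 0 <= n%:R :> K by [].
have H1 : 0 <= c * (n%:R * (sqn x - R ^+ 2)).
  by rewrite mulr_le0 // mulr_ge0_le0 // subr_le0.
have H2 : c * R ^+ 2 <= c * sqn x by rewrite ler_wnM2l.
have H3 : b' * (sqn x - R ^+ 2) <= 0 by rewrite mulr_ge0_le0 // subr_le0.
nra.
Qed.

End LowerBarrier.

(** * Comparison from below for the coupled system *)

Section System.
Context {K : realType} {n : nat}.
Implicit Types (x y : 'rV[K]_n) (u v : 'rV[K]_n -> K -> K).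

Lemma solution_sym (p q R T : K) (u0 v0 : 'rV[K]_n -> K) u v :
  solution p q R u0 v0 T u v -> solution q p R v0 u0 T v u.
Proof. by case=> *; split. Qed.

(** Lower barriers see the exponential flux only through this quadratic bound. For [z >= 1] it
    follows from [z ^ p >= z] and [expR z >= (1 + z / 2)^2]. *)
Lemma flux_gt (p z : K) : 1 < p -> 0 <= z -> z ^+ 2 / 4 < expR (z `^ p).
Proof.
move=> p1 z0; have [z1|z1] := ltP z 1.
  apply: (@lt_le_trans _ _ 1); first by nra.
  by rewrite -[leLHS]expR0 ler_expR powR_ge0.
have zp : z <= z `^ p by rewrite -[leLHS](powRr1 z0) ler_powR // ltW.
apply: (@lt_le_trans _ _ (expR z)); last by rewrite ler_expR.
have -> : expR z = expR (z / 2) ^+ 2 by rewrite -expRM_natr; congr expR; lra.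
have := expR_ge1Dx (z / 2); nra.
Qed.

Lemma solution_continuous (R T t0 t1 : K) u :
  classical_regularity R T u -> 0 <= t0 -> t1 < T ->
  {within cball R `*` `[t0, t1], continuous (fun z : 'rV[K]_n * K => u z.1 z.2)}.
Proof.
move=> ru t00 t1T; apply: continuous_subspaceW (cr_cont ru).
move=> [x t] [/= xR]; rewrite in_itv /= => /andP[a b]; split => //=.
by rewrite in_itv /= (le_trans t00 a) (le_lt_trans b t1T).
Qed.

Lemma solution_bounded (R T t1 : K) u : 0 < R ->
  classical_regularity R T u -> t1 < T ->
  exists m, forall x t, cball R x -> 0 <= t <= t1 -> u x t <= m.
Proof.
move=> R0 ru t1T; have [t10|t10] := ltP t1 0.
  by exists 0 => x t _ /andP[a b]; move: (le_lt_trans (le_trans a b) t10); rewrite ltxx.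
have [||[c s] /= _ H] := @compact_EVT_max _ K (fun z : 'rV[K]_n * K => u z.1 z.2)
    (cball R `*` `[0, t1]) _ _ (solution_continuous ru (lexx 0) t1T).
- exists (0, 0); split => /=; last by rewrite in_itv /= lexx.
  apply/cballP => //; rewrite /sqn big1 ?sqr_ge0 // => i _.
  by rewrite mxE expr0n.
- by apply: compact_setX; [exact: cball_compact|exact: segment_compact].
exists (u c s) => x t xR tI; apply: (H (x, t)).
by apply/mem_set; split => //=; rewrite in_itv.
Qed.

(** At the first touching time both orderings still hold weakly. On the sphere the barriers equal
    [au] and [av], so the ordering of one component bounds from below the flux of the other. *)
Lemma lower_comparison (p q R T t0 t1 cu cv : K) (u0 v0 : 'rV[K]_n -> K) u v
    (au bu av bv : K -> K) :
  0 < R -> solution p q R u0 v0 T u v -> 0 <= t0 -> t1 < T ->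
  @subbarrier K n R cu t0 t1 au bu -> @subbarrier K n R cv t0 t1 av bv ->
  (forall t z, t0 <= t <= t1 -> 0 <= z -> av t <= z -> 2 * R * bu t < expR (z `^ p)) ->
  (forall t z, t0 <= t <= t1 -> 0 <= z -> au t <= z -> 2 * R * bv t < expR (z `^ q)) ->
  (forall x, cball R x -> quad (au t0) (bu t0) cu R x < u x t0 /\
     quad (av t0) (bv t0) cv R x < v x t0) ->
  forall x t, cball R x -> t0 <= t <= t1 ->
    quad (au t) (bu t) cu R x < u x t /\ quad (av t) (bv t) cv R x < v x t.
Proof.
move=> R0 sol t00 t1T su sv fu fv init x t xR tI.
apply: contrapT => nlt.
have [] := @first_touch_pair K _ (cball R) t0 t1
  (fun z => quad (au z.2) (bu z.2) cu R z.1 - u z.1 z.2)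
  (fun z => quad (av z.2) (bv z.2) cv R z.1 - v z.1 z.2) (cball_compact R0).
- apply: within_continuousB; first exact: (barrier_continuous su).
  exact: (solution_continuous (sol_regu sol)).
- apply: within_continuousB; first exact: (barrier_continuous sv).
  exact: (solution_continuous (sol_regv sol)).
- by move=> y /init[? ?] /=; rewrite !subr_lt0.
- exists x, t; split => //=; rewrite !subr_ge0.
  by have [H1|H1] := leP (u x t) _; [left|right; rewrite leNgt; apply/negP => ?; apply: nlt].
move=> y [s [yR sI E le]].
have le' z r : cball R z -> t0 <= r <= s ->
    quad (au r) (bu r) cu R z <= u z r /\ quad (av r) (bv r) cv R z <= v z r.
  by move=> zR rI; have [] := le z r zR rI; rewrite /= !subr_le0.
have sI' : t0 <= s <= t1 by move: sI => /andP[/ltW -> ->].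
have sT : 0 < s < T by move: sI => /andP[? ?]; apply/andP; split; lra.
have [leu lev] := le' y s yR ltac:(by move: sI' => /andP[-> _]; rewrite lexx).
have sphere_quad (a b c : K) : esphere R y -> quad a b c R y = a.
  by move=> /(esphereP _ R0) yS; rewrite /quad yS subrr expr0n /= !mulr0 !addr0.
case: E => /eqP; rewrite subr_eq0 => /eqP E.
  apply: (barrier_no_touch R0 (sol_regu sol) (sol_heatu sol) su t00 t1T sI yR E).
    by move=> z r zR rI; case: (le' z r zR rI).
  move=> yS; exists (expR (v y s `^ p)); first exact: sol_bdu sol _ _ yS sT.
  apply: fu => //; first by apply: (sol_v_ge0 sol) => //; move: sT => /andP[/ltW -> ->].
  by rewrite -(sphere_quad (av s) (bv s) cv yS).
apply: (barrier_no_touch R0 (sol_regv sol) (sol_heatv sol) sv t00 t1T sI yR E).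
  by move=> z r zR rI; case: (le' z r zR rI).
move=> yS; exists (expR (u y s `^ q)); first exact: sol_bdv sol _ _ yS sT.
apply: fv => //; first by apply: (sol_u_ge0 sol) => //; move: sT => /andP[/ltW -> ->].
by rewrite -(sphere_quad (au s) (bu s) cu yS).
Qed.

End System.

(** * Forced blow-up from large data *)

Section Rate.
Context {K : realType} {n : nat}.
Implicit Types (x y : 'rV[K]_n) (u v : 'rV[K]_n -> K -> K).

Lemma is_derive_affine (a b t : K) : is_derive t 1 (fun s => a + b * s) b.
Proof.
have -> : (fun s => a + b * s) = cst a + b *: id by apply/funext => s; rewrite !fctE.
have D := is_deriveD (is_derive_cst a t (1 : K)) (is_deriveZ b (is_derive_id t 1)).
by apply: (is_derive_eq D); rewrite add0r [_ *: _]mulr1.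
Qed.

Lemma is_derive_hyperbola (k Ts t : K) : k != 0 -> t < Ts ->
  is_derive t 1 (fun s => (k * (Ts - s))^-1) (k * ((k * (Ts - t))^-1) ^+ 2).
Proof.
move=> k0 tT.
have D : is_derive t 1 (fun s => k * (Ts - s)) (- k).
  have -> : (fun s => k * (Ts - s)) = (fun s => k * Ts + (- k) * s).
    by apply/funext => s; ring.
  exact: is_derive_affine.
have nz : k * (Ts - t) != 0 by rewrite mulf_neq0 // subr_eq0 gt_eqF.
have := @is_deriveV K (fun s => k * (Ts - s)) t (- k) 1 nz D; rewrite /GRing.scale /=.
by move=> H; apply: (is_derive_eq H); rewrite exprVn; ring.
Qed.

Hypothesis n_gt0 : (0 < n)%N.

(** With [k = n / (8 R)], the function [a] solves [a' = k a^2] and blows up at [Ts]. The choice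
    [b = a^2 / (8 R)] gives the flux [a^2 / 4] of [flux_gt] and [2 n b = 2 k a^2 > a']. As [u] is
    bounded up to [Ts < T], domination of the barrier is absurd. *)
Lemma blow_up_barrier (p q R T t1 Ts : K) (u0 v0 : 'rV[K]_n -> K) u v :
  1 < p -> 1 < q -> 0 < R -> solution p q R u0 v0 T u v -> 0 <= t1 -> t1 < Ts -> Ts < T ->
  (forall x, cball R x ->
    let y := (n%:R / (8 * R) * (Ts - t1))^-1 in
    y + y ^+ 2 / (8 * R) * (sqn x - R ^+ 2) < u x t1 /\
    y + y ^+ 2 / (8 * R) * (sqn x - R ^+ 2) < v x t1) ->
  False.
Proof.
move=> p1 q1 R0 sol t10 t1Ts TsT init.
have n0 : 0 < n%:R :> K by rewrite ltr0n.
pose k : K := n%:R / (8 * R).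
have k0 : 0 < k by rewrite divr_gt0 // mulr_gt0.
pose a s := (k * (Ts - s))^-1.
pose b s := (8 * R)^-1 * a s ^+ 2.
have a0 s : s < Ts -> 0 < a s by move=> sT; rewrite invr_gt0 mulr_gt0 // subr_gt0.
have [m um] := solution_bounded R0 (sol_regu sol) TsT.
(* The barrier height [a] reaches [m'], an upper bound of [u], at the time [t2] below; including
   [a t1] in the maximum ensures [t1 <= t2]. *)
pose m' := Num.max m (a t1).
have am' : 0 < m' by rewrite lt_max a0 // orbT.
pose t2 := Ts - (k * m')^-1.
have t2T : t2 < Ts by rewrite /t2 ltrBlDr ltrDl invr_gt0 mulr_gt0.
have at2 : a t2 = m'.
  rewrite /a /t2 opprB addrC subrK; field.
  by rewrite !lt0r_neq0.
have t12 : t1 <= t2.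
  have kT : 0 < k * (Ts - t1) by rewrite mulr_gt0 // subr_gt0.
  have km : 0 < k * m' by rewrite mulr_gt0.
  have : a t1 * (k * (Ts - t1)) <= m' * (k * (Ts - t1)).
    by rewrite ler_pM2r // le_max lexx orbT.
  rewrite /a mulVf; last exact: lt0r_neq0.
  move=> H; rewrite /t2 lerBrDr -lerBrDl -[leLHS]div1r ler_pdivrMr //; lra.
have Da s : s < Ts -> is_derive s 1 a (k * a s ^+ 2).
  by move=> sT; apply: is_derive_hyperbola => //; exact: lt0r_neq0.
have sub : @subbarrier K n R 0 t1 t2 a b.
  split => // s /andP[_ st2]; have sT := le_lt_trans st2 t2T.
  have as0 := a0 s sT.
  exists (k * a s ^+ 2), ((8 * R)^-1 * (2 * a s * (k * a s ^+ 2))); split.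
  - exact: Da.
  - have D := is_deriveZ (8 * R)^-1 (is_deriveX 2 (Da s sT)).
    have -> : b = (8 * R)^-1 *: (a ^+ 2) by apply/funext => z; rewrite !fctE.
    by apply: (is_derive_eq D); rewrite /GRing.scale /= expr1; ring.
  - apply: mulr_ge0; first by rewrite invr_ge0 mulr_ge0 // ltW.
    apply: mulr_ge0; first by rewrite mulr_ge0 // ltW.
    by rewrite mulr_ge0 ?sqr_ge0 // ltW.
  - rewrite mulr0 mul0r addr0 /b /k.
    have -> : 2 * n%:R * ((8 * R)^-1 * a s ^+ 2) = 2 * (n%:R / (8 * R) * a s ^+ 2).
      by ring.
    have : 0 < k * a s ^+ 2 by apply: mulr_gt0 => //; apply: exprn_gt0.
    by rewrite -/k; lra.
have flux (r : K) : 1 < r -> forall t z, t1 <= t <= t2 -> 0 <= z -> a t <= z ->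
    2 * R * b t < expR (z `^ r).
  move=> r1 t z /andP[_ tt2] z0 az; apply: le_lt_trans (flux_gt r1 z0).
  have at0 := a0 t (le_lt_trans tt2 t2T).
  have -> : 2 * R * b t = a t ^+ 2 / 4 by rewrite /b; field; rewrite lt0r_neq0.
  by rewrite ler_pM2r ?invr_gt0 // ler_pXn2r // ?nnegrE // ltW.
(* At a point of the sphere the barrier equals [a], so at [t2] it gives [u > m'] there. *)
have [i0 _] : exists i : 'I_n, True by exists (Ordinal n_gt0).
have eS : sqn (R *: e_ i0 : 'rV[K]_n) = R ^+ 2 by rewrite sqnZ sqn_delta mulr1.
have eC : cball R (R *: e_ i0 : 'rV[K]_n) by apply/cballP => //; rewrite eS.
have init' x : cball R x -> quad (a t1) (b t1) 0 R x < u x t1 /\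
    quad (a t1) (b t1) 0 R x < v x t1.
  move=> /init; rewrite /quad /b -/k -/(a t1) !mul0r !addr0.
  by rewrite ![_ / (8 * R)]mulrC.
have t22 : t1 <= t2 <= t2 by rewrite t12 lexx.
have [] := lower_comparison R0 sol t10 (lt_trans t2T TsT) sub sub
  (flux p p1) (flux q q1) init' eC t22.
rewrite /quad eS subrr expr0n /= !mulr0 !addr0 at2 => lt _.
have := um _ t2 eC; rewrite (le_trans t10 t12) (ltW t2T) => /(_ isT) H.
have : m <= m' by rewrite le_max lexx.
by move=> /(le_trans H); rewrite leNgt lt.
Qed.

Variables (p q R T : K) (u0 v0 : 'rV[K]_n -> K) (u v : 'rV[K]_n -> K -> K).
Hypotheses (p1 : 1 < p) (q1 : 1 < q) (R0 : 0 < R).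
Hypothesis sol : solution p q R u0 v0 T u v.

(** Of the three conditions on [tau], the first limits the loss of height of the barrier for [u] to
    [M / 2]. The second confines the positive part of the blow-up barrier at time [t0 + tau] to a
    shell near the sphere. The third makes that barrier at most [M / 4]. *)
Lemma rate_contradiction (r M tau t0 : K) x0 :
  0 < r < R -> 0 < M -> 0 < tau -> 0 <= t0 -> t0 + 2 * tau < T ->
  18 * R ^+ 2 * tau <= (R ^+ 2 - r ^+ 2) ^+ 2 ->
  2 * n%:R * tau <= R ^+ 2 - r ^+ 2 ->
  32 * R <= M * (n%:R * tau) ->
  sqn x0 <= r ^+ 2 ->
  (forall x, sqn x0 <= sqn x -> cball R x -> 2 * M <= u x t0) ->
  False.
Proof.
move=> /andP[r0 rR] M0 tau0 t00 tT tau1 tau2 tau3 x0r mono.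
have n0 : 0 < n%:R :> K by rewrite ltr0n.
have w0 : 0 < R ^+ 2 - r ^+ 2 by rewrite subr_gt0 ltr_pXn2r // nnegrE ltW.
move: w0 tau1 tau2; move wE : (R ^+ 2 - r ^+ 2) => w w0 tau1 tau2.
(* On [t0, t0 + tau] the barrier for u is M - L(t - t0) + c(|x|^2 - R^2)^2, which
   is negative for |x| < r, and the one for v is linear in |x|^2 with the flux
   (M/2)^2/4 guaranteed by u >= M/2 on the sphere. *)
pose c := - (M / w ^+ 2).
have cw : c * w ^+ 2 = - M by rewrite /c mulNr divfK // lt0r_neq0 // exprn_gt0.
have c0 : c < 0 by rewrite oppr_lt0 divr_gt0 // exprn_gt0.
(* With [b = 0] the subsolution condition asks for [L > 8 (-c) R^2]; the factor 9 gives strictness,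
   and [18 R^2 tau <= w^2] then gives [L tau <= M / 2]. *)
pose L := 9 * (- c) * R ^+ 2.
have R20 : 0 < R ^+ 2 by rewrite exprn_gt0.
have Lt : L * tau <= M / 2.
  rewrite /L; have : - c * (18 * R ^+ 2 * tau) <= - c * w ^+ 2.
    by rewrite ler_wpM2l // oppr_ge0 ltW.
  rewrite [X in _ <= X]mulNr cw; lra.
have L0 : 0 < L by rewrite /L mulr_gt0 // mulr_gt0 // oppr_gt0.
pose be := M ^+ 2 / (32 * R).
have be0 : 0 < be by rewrite divr_gt0 // ?exprn_gt0 // mulr_gt0.
pose au s := (M + L * t0) + (- L) * s.
(* That is [be (3/2 n (s - t0) - n tau / 4)]: negative at [t0], where only [v >= 0] is known, equal
   to [5/4 be n tau] at [t0 + tau], and of slope below [2 n be]. *)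
pose av s := (be * (- (n%:R * tau / 4) - 3 / 2 * n%:R * t0)) + (be * (3 / 2) * n%:R) * s.
have lc := @lower_comparison K n p q R T t0 (t0 + tau) c 0 u0 v0 u v
  au (fun=> 0) av (fun=> be) R0 sol t00.
have sc x : cball R x -> sqn x <= R ^+ 2 by move/cballP; exact.
have T0 : 0 <= t0 < T by apply/andP; split; lra.
have cmp : forall x t, cball R x -> t0 <= t <= t0 + tau ->
    quad (au t) 0 c R x < u x t /\ quad (av t) be 0 R x < v x t.
  apply: lc.
  - lra.
  - split; first exact: ltW.
    move=> t _; exists (- L), 0.
    split; [exact: is_derive_affine|exact: is_derive_cst|by []|].
    rewrite mulr0 add0r /L; have : 0 < - c * R ^+ 2 by rewrite mulr_gt0 // oppr_gt0.
    lra.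
  - split => //; move=> t _; exists (be * (3 / 2) * n%:R), 0.
    split; [exact: is_derive_affine|exact: is_derive_cst|by []|].
    have : 0 < be * n%:R by rewrite mulr_gt0.
    by rewrite mulr0 mul0r; lra.
  - by move=> t z _ _ _; rewrite mulr0 expR_gt0.
  - move=> t z /andP[tt0 tt1] z0 az; apply: le_lt_trans (flux_gt q1 z0).
    have -> : 2 * R * be = (M / 2) ^+ 2 / 4 by rewrite /be; field; rewrite lt0r_neq0.
    have M20 : 0 <= M / 2 by lra.
    rewrite ler_pM2r ?invr_gt0 // ler_pXn2r // ?nnegrE //.
    apply: le_trans az; rewrite /au.
    have : L * (t - t0) <= L * tau by rewrite ler_wpM2l ?(ltW L0) //; lra.
    lra.
  - move=> x xR; have xs := sc x xR; rewrite /quad; split.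
      rewrite mul0r addr0 /au.
      have [xx0|x0x] := ltP (sqn x) (sqn x0).
        apply: (@lt_le_trans _ _ 0); last exact: sol_u_ge0 sol _ _ xR T0.
        have h : w ^+ 2 < (sqn x - R ^+ 2) ^+ 2.
          rewrite -(sqrrN (sqn x - _)) ltr_pXn2r // ?nnegrE; lra.
        have : c * (sqn x - R ^+ 2) ^+ 2 < c * w ^+ 2 by rewrite ltr_nM2l.
        rewrite cw; lra.
      have := mono x x0x xR.
      have : c * (sqn x - R ^+ 2) ^+ 2 <= 0 by rewrite mulr_le0_ge0 ?sqr_ge0 // ltW.
      lra.
    apply: (@lt_le_trans _ _ 0); last exact: sol_v_ge0 sol _ _ xR T0.
    have : be * (sqn x - R ^+ 2) <= 0 by rewrite mulr_ge0_le0 ?(ltW be0) // subr_le0.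
    have : 0 < be * (n%:R * tau) by rewrite mulr_gt0 // mulr_gt0.
    rewrite /av; lra.
apply: (@blow_up_barrier p q R T (t0 + tau) (t0 + 2 * tau) u0 v0 u v p1 q1 R0 sol);
  [lra|lra|lra|].
move=> x xR /=.
have T1 : 0 <= t0 + tau < T by apply/andP; split; lra.
have [cu cv] := cmp x (t0 + tau) xR ltac:(by apply/andP; split; lra).
have -> : t0 + 2 * tau - (t0 + tau) = tau by ring.
have xs := sc x xR.
set y := (n%:R / (8 * R) * tau)^-1.
pose al := 8 * R / (n%:R * tau) ^+ 2.
have nt0 : 0 < n%:R * tau by rewrite mulr_gt0.
have al0 : 0 < al by rewrite divr_gt0 // ?mulr_gt0 ?exprn_gt0.
(* In this form the blow-up barrier is seen to be positive only where
   [R^2 - |x|^2 < n tau <= w / 2]; elsewhere nonnegativity of the solution is enough. *)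
have -> : y + y ^+ 2 / (8 * R) * (sqn x - R ^+ 2) = al * (n%:R * tau + (sqn x - R ^+ 2)).
  by rewrite /y /al; field; rewrite !lt0r_neq0.
have alnt : al * (n%:R * tau) <= M / 4.
  have -> : al * (n%:R * tau) = 8 * R / (n%:R * tau) by rewrite /al; field; rewrite !lt0r_neq0.
  rewrite ler_pdivrMr //; lra.
have [neg|pos] := ltP (n%:R * tau + (sqn x - R ^+ 2)) 0.
  have lt0 : al * (n%:R * tau + (sqn x - R ^+ 2)) < 0 by rewrite pmulr_rlt0.
  split; apply: (lt_le_trans lt0).
    exact: sol_u_ge0 sol _ _ xR T1.
  exact: sol_v_ge0 sol _ _ xR T1.
have alle : al * (n%:R * tau + (sqn x - R ^+ 2)) <= al * (n%:R * tau).
  by rewrite ler_pM2l //; lra.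
split.
  apply: le_lt_trans cu; apply: (le_trans alle); apply: (le_trans alnt).
  rewrite /quad /au mul0r addr0.
  (* In the shell the term with [c] costs at most [M / 4] out of a height of at least [M / 2], which
     leaves the [M / 4] required by [alnt]. *)
  have h : (sqn x - R ^+ 2) ^+ 2 <= (w / 2) ^+ 2.
    by rewrite -(sqrrN (sqn x - _)) ler_pXn2r // ?nnegrE; lra.
  have : c * (w / 2) ^+ 2 <= c * (sqn x - R ^+ 2) ^+ 2 by rewrite ler_nM2l.
  rewrite expr_div_n mulrA cw; lra.
apply: le_lt_trans cv.
have albe : al <= be.
  rewrite /al /be ler_pdivrMr ?exprn_gt0 // mulrAC ler_pdivlMr ?mulr_gt0 // -exprMn.
  have : (16 * R) ^+ 2 <= (M * (n%:R * tau)) ^+ 2 by rewrite ler_pXn2r // ?nnegrE; lra.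
  lra.
apply: (@le_trans _ _ (be * (n%:R * tau + (sqn x - R ^+ 2)))).
  by rewrite ler_wpM2r.
rewrite /quad /av; have : 0 < be * (n%:R * tau) by rewrite mulr_gt0.
lra.
Qed.

End Rate.

(** * Interior bounds *)

Section InteriorBound.
Context {K : realType} {n : nat}.
Implicit Types (x y : 'rV[K]_n) (u v : 'rV[K]_n -> K -> K).

(** [rate_contradiction] is applied at time [t] with [tau] a fixed fraction [de] of the remaining
    time [T - t]; radial monotonicity spreads a large value at [x] to all points farther out. *)
Lemma rate_bound (p q R T r : K) (u0 v0 : 'rV[K]_n -> K) u v : (0 < n)%N ->
  1 < p -> 1 < q -> 0 < r < R -> solution p q R u0 v0 T u v ->
  (forall x y t, 0 <= t < T -> cball R y -> sqn x <= sqn y -> u x t <= u y t) ->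
  exists2 C, 0 < C & forall x t, sqn x <= r ^+ 2 -> 0 <= t < T -> u x t * (T - t) <= C.
Proof.
move=> n_gt0 p1 q1 /andP[r0 rR] sol mono.
have n0 : 0 < n%:R :> K by rewrite ltr0n.
have R0 : 0 < R by exact: lt_trans rR.
have T0 : 0 < T := sol_T_gt0 sol.
have w0 : 0 < R ^+ 2 - r ^+ 2 by rewrite subr_gt0 ltr_pXn2r // nnegrE ltW.
pose w := R ^+ 2 - r ^+ 2.
(* The bound [1 / 3] gives [t + 2 tau < T]; the other two are the geometric conditions on [tau],
   with [T - t] replaced by its upper bound [T]. *)
have [de [de0 de1 de2 de3]] : exists de : K, [/\ 0 < de, de <= 1 / 3,
    18 * R ^+ 2 * (de * T) <= w ^+ 2 & 2 * n%:R * (de * T) <= w].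
  pose d1 := w ^+ 2 / (18 * R ^+ 2 * T); pose d2 := w / (2 * n%:R * T).
  have k1 : 0 < 18 * R ^+ 2 * T by rewrite !mulr_gt0 // exprn_gt0.
  have k2 : 0 < 2 * n%:R * T by rewrite !mulr_gt0.
  exists (Num.min (1 / 3) (Num.min d1 d2)); split.
  - by rewrite !lt_min divr_gt0 //= !divr_gt0 // exprn_gt0.
  - by rewrite ge_min lexx.
  - have : Num.min (1 / 3) (Num.min d1 d2) * (18 * R ^+ 2 * T) <= w ^+ 2.
      by rewrite -ler_pdivlMr // !ge_min lexx !orbT.
    lra.
  - have : Num.min (1 / 3) (Num.min d1 d2) * (2 * n%:R * T) <= w.
      by rewrite -ler_pdivlMr // !ge_min lexx !orbT.
    lra.
exists (64 * R / (n%:R * de)); first by rewrite divr_gt0 // mulr_gt0.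
move=> x t xr tT; move: (tT) => /andP[t0 t1].
rewrite leNgt; apply/negP => big.
have Tt : 0 < T - t by rewrite subr_gt0.
have deTt : 0 < de * (T - t) by rewrite mulr_gt0.
have ltT : de * (T - t) <= de * T by rewrite ler_pM2l //; lra.
(* This makes [32 R <= M n tau] an equality, and [2 M (T - t)] is exactly the claimed constant. *)
pose M := 32 * R / (n%:R * (de * (T - t))).
have M0 : 0 < M by rewrite divr_gt0 // !mulr_gt0.
apply: (@rate_contradiction K n n_gt0 p q R T u0 v0 u v p1 q1 R0 sol r M
  (de * (T - t)) t x) => //.
- by rewrite r0.
- have : de * (T - t) <= 1 / 3 * (T - t) by rewrite ler_pM2r.
  lra.
- by apply: le_trans de2; rewrite ler_pM2l // !mulr_gt0 // exprn_gt0.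
- by apply: le_trans de3; rewrite ler_pM2l // !mulr_gt0.
- by rewrite /M divfK // lt0r_neq0 // !mulr_gt0.
- move=> y xy yR; apply: le_trans (mono x y t tT yR xy).
  rewrite -(ler_pM2r Tt); apply/ltW; apply: le_lt_trans big.
  rewrite le_eqVlt; apply/orP; left; apply/eqP; rewrite /M; field.
  by rewrite !lt0r_neq0.
Qed.

Lemma second_difference_inv (D D1 : K -> K) (D2 C : K) :
  (forall s, 0 < D s) -> (forall s : K, is_derive s 1 D (D1 s)) ->
  is_derive (0 : K) 1 D1 D2 ->
  (C / D h + C / D (- h) - 2 * (C / D 0)) / h ^+ 2 @[h --> 0^'+] -->
    C / D 0 ^+ 2 * (2 * D1 0 ^+ 2 / D 0 - D2).
Proof.
move=> D0 dD dD1.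
have D0' s : D s != 0 by exact: lt0r_neq0.
apply: (@second_difference_cvg K (fun s => C / D s)
  (fun s => - C * (D1 s / D s ^+ 2)) _ 1) => //.
  move=> s _; have H := is_deriveZ C (is_deriveV (D0' s) (dD s)).
  by apply: (is_derive_eq H); rewrite /GRing.scale /=; ring.
have H1 := is_deriveX 2 (dD 0).
have D02 : (D ^+ 2) 0 != 0 by rewrite !fctE expf_neq0.
have H := is_deriveZ (- C) (is_deriveM dD1 (is_deriveV D02 H1)).
have -> : (fun s => - C * (D1 s / D s ^+ 2)) = - C *: (D1 * (fun z => ((D ^+ 2) z)^-1)).
  by apply/funext => s; rewrite !fctE.
apply: (is_derive_eq H); rewrite /GRing.scale /= !fctE; field.
exact: D0'.
Qed.

(** At [t = T] the denominator vanishes only on the sphere of radius [r]. On that sphere the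
    function is [C1 / (C2 (T - t))], comparable with the blow-up rate, while strictly inside it
    stays bounded. *)
Definition hump (r C1 C2 T : K) x (t : K) : K :=
  C1 / ((sqn x - r ^+ 2) ^+ 2 + C2 * (T - t)).

Lemma sdiff2_hump (r C1 C2 T t : K) x (i : 'I_n) : 0 < C2 -> t < T ->
  let D := (sqn x - r ^+ 2) ^+ 2 + C2 * (T - t) in
  sdiff2 (hump r C1 C2 T ^~ t) x (e_ i) h @[h --> 0^'+] -->
    C1 / D ^+ 2 * (2 * (4 * (sqn x - r ^+ 2) * x 0 i) ^+ 2 / D -
      (8 * x 0 i ^+ 2 + 4 * (sqn x - r ^+ 2))).
Proof.
move=> C20 tT D; set m := x 0 i; set sg := sqn x - r ^+ 2; set k := C2 * (T - t).
have k0 : 0 < k by rewrite mulr_gt0 // subr_gt0.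
(* [P s] is the value of [sqn - r ^+ 2] at [x + s *: e_ i]. *)
pose P s : K := sg + 2 * m * s + s ^+ 2.
have dP (s : K) : is_derive s 1 P (2 * m + 2 * s).
  have -> : P = cst sg + (2 * m) *: id + id ^+ 2 by apply/funext => z; rewrite !fctE.
  have D1 := is_deriveD (is_derive_cst sg s (1 : K)) (is_deriveZ (2 * m) (is_derive_id s 1)).
  have D2 := is_deriveD D1 (is_deriveX 2 (is_derive_id s 1)).
  by apply: (is_derive_eq D2); rewrite /GRing.scale /= expr1; ring.
pose DD s := P s ^+ 2 + k; pose D1 s := 2 * P s * (2 * m + 2 * s).
have dDD (s : K) : is_derive s 1 DD (D1 s).
  have -> : DD = P ^+ 2 + cst k by apply/funext => z; rewrite !fctE.
  by apply: is_derive_eq; rewrite /D1 /GRing.scale /= expr1; ring.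
have dQ (s : K) : is_derive s 1 (fun s => 2 * m + 2 * s) 2 by exact: is_derive_affine.
have dD1 : is_derive (0 : K) 1 D1 (8 * m ^+ 2 + 4 * sg).
  have -> : D1 = 2 *: (P * (fun s => 2 * m + 2 * s)).
    by apply/funext => z; rewrite !fctE /D1 -mulrA.
  have H := is_deriveZ (2 : K) (is_deriveM (dP 0) (dQ 0)).
  by apply: (is_derive_eq H); rewrite /GRing.scale /= /P; ring.
have DD0 s : 0 < DD s by rewrite /DD ltr_wpDl // sqr_ge0.
have P0 : P 0 = sg by rewrite /P mulr0 expr0n /= !addr0.
have := @second_difference_inv DD D1 _ C1 DD0 dDD dD1.
have -> : DD 0 = D by rewrite /DD P0.
have -> : D1 0 = 4 * sg * m by rewrite /D1 P0; ring.
apply: cvg_trans; apply: near_eq_cvg; near=> h.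
rewrite /sdiff2 /hump sqnBZ sqnDZ dotp_delta sqn_delta -/m -/k /DD /P.
congr ((C1 / (_ ^+ 2 + k) + C1 / (_ ^+ 2 + k) - _) / _); rewrite /sg; ring.
Unshelve. all: by end_near.
Qed.

(** [hump] stays above [u] on the ball of radius [r]: at time 0 and on the sphere by the choice of
    [C1], inside by the choice of [C2]. On the ball of radius [r'] its denominator is bounded
    below. *)
Lemma interior_bound (R T r r' C : K) u :
  0 < r' < r -> r < R -> 0 < T -> 0 < C -> classical_regularity R T u ->
  (forall x (t : K), eball R x -> 0 < t < T -> 'D_1 (u x) t = laplacian (u^~ t) x) ->
  (forall x t, sqn x <= r ^+ 2 -> 0 <= t < T -> u x t * (T - t) <= C) ->
  exists B, forall x t, sqn x <= r' ^+ 2 -> 0 <= t < T -> u x t <= B.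
Proof.
move=> /andP[r'0 r'r] rR T0 C0 ru heat rate.
have r0 : 0 < r := lt_trans r'0 r'r.
have R0 : 0 < R := lt_trans r0 rR.
have r20 : 0 < r ^+ 2 by rewrite exprn_gt0.
pose C2 : K := (24 + 4 * n%:R) * r ^+ 2 + 1.
have n0 : 0 <= n%:R :> K by [].
have C20 : 0 < C2 by rewrite /C2; nra.
(* The first summand handles the sphere, where [C1 / C2 > C] is needed, and the second the initial
   time, where the denominator is at most [r^4 + C2 T]. *)
pose C1 := C * C2 + C * (r ^+ 4 + C2 * T) / T.
have C1a : 0 < C * C2 by rewrite mulr_gt0.
have C1b : 0 < C * (r ^+ 4 + C2 * T) / T.
  by rewrite divr_gt0 // mulr_gt0 // addr_gt0 ?exprn_gt0 // mulr_gt0.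
have C10 : 0 < C1 by rewrite addr_gt0.
have ww0 : 0 < (r ^+ 2 - r' ^+ 2) ^+ 2.
  by rewrite exprn_gt0 // subr_gt0 ltr_pXn2r // nnegrE ltW.
exists (C1 / (r ^+ 2 - r' ^+ 2) ^+ 2) => x t xr' tT.
have rr : r' ^+ 2 < r ^+ 2 by rewrite ltr_pXn2r // nnegrE ltW.
apply: (@le_trans _ _ (hump r C1 C2 T x t)); last first.
  move: tT => /andP[t0 tT]; rewrite /hump ler_pM2l // lef_pV2 ?posrE //.
    rewrite -[_ ^+ 2 in leLHS]sqrrN opprB.
    have : (r ^+ 2 - r' ^+ 2) ^+ 2 <= (r ^+ 2 - sqn x) ^+ 2.
      by rewrite ler_pXn2r // ?nnegrE; lra.
    have : 0 <= C2 * (T - t) by rewrite mulr_ge0 ?(ltW C20) // subr_ge0 ltW.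
    by rewrite -[(sqn x - _) ^+ 2]sqrrN opprB; lra.
  by rewrite ltr_wpDl ?sqr_ge0 // mulr_gt0 // subr_gt0.
rewrite leNgt; apply/negP => lt_hump.
have Dpos y (s : K) : s < T -> 0 < (sqn y - r ^+ 2) ^+ 2 + C2 * (T - s).
  by move=> sT; rewrite ltr_wpDl ?sqr_ge0 // mulr_gt0 // subr_gt0.
have sub_r y : cball r y -> cball R y.
  move=> /cballP H; apply/cballP => //; apply: le_trans (H r0) _.
  by rewrite ler_pXn2r ?nnegrE // ltW.
move: (tT) => /andP[t0 t1].
have cF : {within cball r `*` `[0, t],
    continuous (fun z : 'rV[K]_n * K => u z.1 z.2 - hump r C1 C2 T z.1 z.2)}.
  apply: within_continuousB.
    apply: continuous_subspaceW (solution_continuous ru (lexx 0) t1).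
    by move=> [y s] [/= yr sI]; split => //=; exact: sub_r.
  apply/subspace_continuousP => -[y s] [/= _]; rewrite in_itv /= => /andP[_ st].
  apply: cvg_within_filter.
  have sT := le_lt_trans st t1.
  apply: cvgM; first exact: cvg_cst.
  apply: cvgV; first exact/lt0r_neq0/Dpos.
  have S : sqn z.1 - r ^+ 2 @[z --> nbhs (y, s)] --> sqn y - r ^+ 2.
    apply: cvgB; last exact: cvg_cst.
    by apply: (@cvg_comp _ _ _ fst sqn _ (nbhs y)); [exact: cvg_fst|exact: sqn_continuous].
  apply: cvgD; first by rewrite !expr2; exact: (cvgM S S).
  apply: cvgM; first exact: cvg_cst.
  by apply: cvgB; [exact: cvg_cst|exact: cvg_snd].
have [||y [s [yr /andP[s0 st] E le]]] := first_touch (cball_compact r0) cF.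
- move=> y /(cballP _ r0) yr /=; rewrite subr_lt0.
  have := rate y 0 yr; rewrite lexx T0 subr0 => /(_ isT).
  rewrite -ler_pdivlMr // => /le_lt_trans; apply.
  rewrite /hump subr0 ltr_pdivlMr; last by have := Dpos y 0 T0; rewrite subr0.
  apply: (@le_lt_trans _ _ (C / T * (r ^+ 4 + C2 * T))).
    rewrite ler_pM2l ?divr_gt0 // lerD2r.
    have -> : r ^+ 4 = (r ^+ 2) ^+ 2 by rewrite -exprM.
    rewrite -sqrrN opprB ler_pXn2r // ?nnegrE; have := sqn_ge0 y; lra.
  by rewrite /C1 mulrAC ltrDr.
- exists x, t; split; first (apply/cballP => //; lra); first by rewrite t0 lexx.
  by rewrite /= subr_ge0 ltW.
move: E => /eqP; rewrite /= subr_eq0 => /eqP E.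
have sT : s < T := le_lt_trans st t1.
have Ts : 0 < T - s by rewrite subr_gt0.
have yR : sqn y <= r ^+ 2 by apply/cballP.
have := yR; rewrite le_eqVlt => /orP[/eqP ys|yb].
  have := rate y s yR; rewrite (ltW s0) sT => /(_ isT).
  rewrite E /hump ys subrr expr0n add0r; apply/negP; rewrite -ltNge.
  have -> : C1 / (C2 * (T - s)) * (T - s) = C1 / C2.
    by field; rewrite !lt0r_neq0.
  by rewrite ltr_pdivlMr // /C1 ltrDl.
have yB : eball r y by apply/eballP.
have yBR : eball R y.
  by apply/eballP => //; apply: lt_trans yb _; rewrite ltr_pXn2r // nnegrE ltW.
have [d d0 dB] := eball_line r0 yB.
have sT' : 0 < s < T by rewrite s0.
set D := (sqn y - r ^+ 2) ^+ 2 + C2 * (T - s).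
have D0 : 0 < D by exact: Dpos.
have dw : is_derive s 1 (hump r C1 C2 T y) (C1 * C2 / D ^+ 2).
  have D1 : is_derive s 1 (fun s => ((sqn y - r ^+ 2) ^+ 2 + C2 * T) + (- C2) * s) (- C2).
    exact: is_derive_affine.
  have Dn : ((sqn y - r ^+ 2) ^+ 2 + C2 * T) + (- C2) * s != 0.
    by rewrite (_ : _ + _ = D) ?lt0r_neq0 // /D; ring.
  have H := is_deriveZ C1 (@is_deriveV K
    (fun s => ((sqn y - r ^+ 2) ^+ 2 + C2 * T) + (- C2) * s) s (- C2) 1 Dn D1).
  have -> : hump r C1 C2 T y =
      C1 *: (fun s => (((sqn y - r ^+ 2) ^+ 2 + C2 * T) + (- C2) * s)^-1).
    apply/funext => z; rewrite !fctE /hump /GRing.scale /=; congr (_ / _); ring.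
  apply: (is_derive_eq H); rewrite /GRing.scale /=.
  have -> : ((sqn y - r ^+ 2) ^+ 2 + C2 * T) + (- C2) * s = D by rewrite /D; ring.
  by ring.
have [] : (-1 * \sum_(i < n) (C1 / D ^+ 2 * (2 * (4 * (sqn y - r ^+ 2) * y 0 i) ^+ 2 / D -
      (8 * y 0 i ^+ 2 + 4 * (sqn y - r ^+ 2)))) <= -1 * (C1 * C2 / D ^+ 2)).
  apply: (touch_interior R0 ru heat (w := hump r C1 C2 T) yBR sT' _ d0 _ dw s0).
  - by move=> i; exact: sdiff2_hump.
  - move=> z zy; rewrite E subrr mulr0 mulN1r oppr_le0 subr_ge0.
    have /le : cball r z by exact/ltW/dB.
    by move=> /(_ s); rewrite (ltW s0) lexx subr_le0; apply.
  - move=> z zI; rewrite E subrr mulr0 mulN1r oppr_le0 subr_ge0.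
    by have := le y z yr zI; rewrite subr_le0.
apply/negP; rewrite -ltNge !mulN1r ltrN2 -mulr_sumr -[ltRHS]mulrA [C2 / _]mulrC mulrA.
rewrite ltr_pM2l ?divr_gt0 ?exprn_gt0 //.
set sg := sqn y - r ^+ 2.
have -> : \sum_(i < n) (2 * (4 * sg * y 0 i) ^+ 2 / D - (8 * y 0 i ^+ 2 + 4 * sg)) =
    (32 * (sg ^+ 2 / D) - 8) * sqn y - 4 * n%:R * sg.
  rewrite (eq_bigr (fun i => (32 * (sg ^+ 2 / D) - 8) * y 0 i ^+ 2 - 4 * sg)).
    by rewrite sumrB -mulr_sumr sumr_const card_ord -mulr_natl -/(sqn y); ring.
  by move=> i _; ring.
(* The singular factor is bounded by 1, so the sum is at most [24 r^2 + 4 n r^2], which is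
   [C2 - 1]. *)
have sg1 : sg ^+ 2 / D <= 1.
  by rewrite ler_pdivrMr // mul1r /D lerDl mulr_ge0 // ltW.
have y0 := sqn_ge0 y.
have sgr : - sg <= r ^+ 2 by rewrite /sg; lra.
have H1 : sg ^+ 2 / D * sqn y <= sqn y by rewrite ler_piMl.
have H2 : n%:R * - sg <= n%:R * r ^+ 2 by rewrite ler_wpM2l.
rewrite /C2; lra.
Qed.

End InteriorBound.

(** * Radial monotonicity *)

(** Only an upper bound [d] on [a - b] is available from the comparison, hence this one-sided form.
    The power is handled by the mean value theorem and the exponential by [1 + z <= expR z]. *)
Lemma flux_lipschitz (K : realType) (p m : K) : 1 < p -> exists2 L, 0 < L &
  forall a b d : K, 0 <= a <= m -> 0 <= b <= m -> 0 <= d -> a - b <= d ->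
    expR (a `^ p) - expR (b `^ p) <= L * d.
Proof.
move=> p1; pose L := expR (m `^ p) * (p * m `^ (p - 1)).
have p0 : 0 < p by lra.
have L0 : 0 <= L by rewrite mulr_ge0 ?expR_ge0 // mulr_ge0 ?powR_ge0 // ltW.
exists (L + 1) => [|a b d /andP[a0 am] /andP[b0 bm] d0 abd]; first lra.
apply: (@le_trans _ _ (L * d)); last by rewrite ler_wpM2r // lerDl.
have [ab|ba] := leP a b.
  apply: (@le_trans _ _ 0); last by rewrite mulr_ge0.
  by rewrite subr_le0 ler_expR ge0_ler_powR // ?nnegrE // ltW.
have a0' : 0 < a := le_lt_trans b0 ba.
have pw : a `^ p - b `^ p <= p * m `^ (p - 1) * (a - b).
  have am1 : a `^ (p - 1) <= m `^ (p - 1).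
    by rewrite ge0_ler_powR // ?nnegrE ?subr_ge0 ?(ltW p1) // (le_trans a0 am).
  (* The derivative of the power is used at positive points only; [b = 0] is settled by writing the
     power of [a] as [a] times its power [p - 1]. *)
  have [b00|b00] := ltP 0 b; last first.
    have -> : b = 0 by apply/le_anti; rewrite b00 b0.
    rewrite powR0 ?subr0; last exact: lt0r_neq0.
    have -> : a `^ p = a `^ (p - 1) * a.
      by rewrite -[X in _ * X](powRr1 a0) -powRD ?subrK // (gt_eqF a0') implybT.
    rewrite ler_wpM2r //; apply: (le_trans am1).
    by rewrite ler_peMl ?powR_ge0 // ltW.
  have D (z : K) : z \in `[b, a] -> is_derive z 1 (@powR K ^~ p) (p * z `^ (p - 1)).
    by rewrite in_itv /= => /andP[bz _]; apply: is_derive1_powR; exact: lt_le_trans bz.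
  have [c] := MVT_segment (ltW ba) (fun s sa => D s (subset_itv_oo_cc sa))
    (derivable_within_continuous (fun s sa => @ex_derive _ _ _ _ _ _ _ (D s sa))).
  rewrite in_itv /= => /andP[bc ca] ->; rewrite ler_wpM2r ?subr_ge0 ?(ltW ba) //.
  rewrite ler_wpM2l ?(ltW p0) // ge0_ler_powR // ?nnegrE ?subr_ge0 ?(ltW p1) //; lra.
have ex : expR (a `^ p) - expR (b `^ p) <= expR (m `^ p) * (a `^ p - b `^ p).
  apply: (@le_trans _ _ (expR (a `^ p) * (a `^ p - b `^ p))); last first.
    have pab : b `^ p <= a `^ p by rewrite ge0_ler_powR // ?nnegrE // ltW.
    have pam : a `^ p <= m `^ p.
      by rewrite ge0_ler_powR ?nnegrE ?(ltW p0) // (le_trans a0 am).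
    by rewrite ler_wpM2r ?subr_ge0 // ler_expR.
  have -> : expR (b `^ p) = expR (a `^ p) * expR (b `^ p - a `^ p).
    by rewrite -expRD; congr expR; ring.
  have := expR_ge1Dx (b `^ p - a `^ p); have := expR_gt0 (a `^ p); nra.
apply: (le_trans ex); rewrite /L -[leRHS]mulrA ler_wpM2l ?expR_ge0 //.
apply: (le_trans pw); rewrite ler_wpM2l // mulr_ge0 ?powR_ge0 //; exact: ltW.
Qed.

(** * Reflections exchanging two points of equal norm *)

Section Householder.
Context {K : realType} {n : nat}.
Implicit Types (x y z : 'rV[K]_n).

Lemma dotp_mulmx x y : x *m y^T = (dotp x y)%:M.
Proof.
apply/matrixP => i j; rewrite !ord1 !mxE eqxx mulr1n.
by apply: eq_bigr => k _; rewrite mxE.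
Qed.

Lemma dotp_sqn x : dotp x x = sqn x.
Proof. by apply: eq_bigr => i _; rewrite expr2. Qed.

Lemma sqn_eq0 x : sqn x = 0 -> x = 0.
Proof.
move=> /eqP; rewrite psumr_eq0 => [/allP H|i _]; last exact: sqr_ge0.
apply/rowP => i; rewrite mxE; apply/eqP; rewrite -sqrf_eq0.
exact: (H i (mem_index_enum i)).
Qed.

Lemma rotation_exists x y : sqn x = sqn y -> exists O : 'M[K]_n,
  [/\ x *m O = y, O *m O^T = 1%:M & O^T *m O = 1%:M].
Proof.
move=> xy; have [->|nxy] := eqVneq x y.
  by exists 1%:M; rewrite mulmx1 trmx1 mulmx1.
have [w wE] : exists w, w = x - y by exists (x - y).
have [s sw] : exists s, s = sqn w by exists (sqn w).
have s0 : s != 0.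
  by rewrite sw; apply/eqP => /sqn_eq0/eqP; rewrite wE subr_eq0 (negbTE nxy).
(* Equality of the norms enters here: it makes the Householder reflection along [w] send [x] to
   [x - w = y]. *)
have sE : s = 2 * dotp x w.
  have -> : dotp x w = sqn x - dotp x y.
    by rewrite wE /dotp /sqn -sumrB; apply: eq_bigr => i _; rewrite !mxE; ring.
  by rewrite sw wE -[y]scale1r sqnBZ -xy scale1r; ring.
have ww : w *m w^T = s%:M by rewrite dotp_mulmx dotp_sqn sw.
pose O : 'M[K]_n := 1%:M - (2 / s) *: (w^T *m w).
have OT : O^T = O.
  by rewrite /O linearB /= trmx1 linearZ /= trmx_mul trmxK.
have OO : O *m O = 1%:M.
  have ww2 : (w^T *m w) *m (w^T *m w) = s *: (w^T *m w).
    by rewrite mulmxA -(mulmxA _ w) ww mul_mx_scalar -scalemxAl.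
  rewrite /O mulmxBl mul1mx mulmxBr mulmx1.
  rewrite -scalemxAl -scalemxAr ww2 !scalerA.
  have -> : 2 / s * (2 / s) * s = 2 / s + 2 / s by field.
  by rewrite scalerDl opprB addrK subrK.
exists O; rewrite OT OO; split => //.
rewrite /O mulmxBr mulmx1 -scalemxAr mulmxA dotp_mulmx mul_scalar_mx scalerA.
have -> : 2 / s * dotp x w = 1.
  by rewrite mulrAC -sE divff.
by rewrite scale1r wE opprB addrC subrK.
Qed.

Lemma sqn_rotation (O : 'M[K]_n) z : O *m O^T = 1%:M -> sqn (z *m O) = sqn z.
Proof.
move=> OO; have : (z *m O) *m (z *m O)^T = z *m z^T.
  by rewrite trmx_mul mulmxA -(mulmxA z) OO mulmx1.
rewrite !dotp_mulmx !dotp_sqn => /matrixP/(_ 0 0).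
by rewrite !mxE eqxx !mulr1n.
Qed.

Lemma frame_rotation (O : 'M[K]_n) : O^T *m O = 1%:M ->
  orthonormal_frame (fun i => e_ i *m O).
Proof.
move=> OO k l; have /matrixP/(_ k l) := OO; rewrite !mxE => <-.
by apply: eq_bigr => i _; rewrite /e_ -rowE !mxE.
Qed.

End Householder.

(** * Radial monotonicity at the initial time *)

Section InitialData.
Context {K : realType} {n : nat}.
Hypothesis n_gt0 : (0 < n)%N.
Implicit Types (x y : 'rV[K]_n) (w : 'rV[K]_n -> K).

Lemma initial_datum_monotone (R : K) w x y : 0 < R -> initial_datum R w ->
  eball R y -> sqn x <= sqn y -> w x <= w y.
Proof.
move=> R0 W yR xy.
pose e := e_ (Ordinal n_gt0) : 'rV[K]_n.
have ee : sqn e = 1 by exact: sqn_delta.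
have ne (s : K) : 0 <= s -> enorm (s *: e) = s.
  by move=> s0; rewrite /enorm -/(sqn _) sqnZ ee mulr1 sqrtr_sqr ger0_norm.
have le_xy : enorm x <= enorm y by rewrite ler_wsqrtr.
have nx0 : 0 <= enorm x by exact: sqrtr_ge0.
have ny0 : 0 <= enorm y by exact: sqrtr_ge0.
have nyR : enorm y < R by [].
have prof z : enorm z < R -> w z = w (enorm z *: e).
  move=> zR; have z0 : 0 <= enorm z by exact: sqrtr_ge0.
  by apply: (id_radial W); rewrite /cball /= ?ne // ltW.
rewrite (prof x (le_lt_trans le_xy nyR)) (prof y nyR).
pose g (s : K) := w (0 + s *: e); pose dg (s : K) := 'D_e w (0 + s *: e).
suff mon : enorm x < enorm y -> g (enorm x) <= g (enorm y).
  move: le_xy; rewrite le_eqVlt => /orP[/eqP -> //|/mon].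
  by rewrite /g !add0r.
have Dg (s : K) : 0 <= s < R -> is_derive s 1 g (dg s).
  move=> /andP[s0 sR]; apply: is_derive_line; apply: derivableP.
  by apply: ((id_smooth W).2 [::]).1; rewrite add0r /eball /= ne.
have dg0 (s : K) : 0 < s < R -> 0 <= dg s.
  move=> /andP[s0 sR].
  have := id_radial_derive_ge0 W (x := s *: e) (e := e).
  rewrite /cball /= (ne _ (ltW s0)) => /(_ (ltW sR)).
  have e1 : enorm e = 1 by rewrite -[e]scale1r ne.
  move=> /(_ e1); rewrite /radial_derive.
  (* At a radius strictly between 0 and [R] the restriction to the segment is void, so the radial
     derivative is the two-sided derivative of the profile. *)
  have -> : within `[0, R] (s^') = s^'.
    have O : nbhs s (`]0, R[%classic : set K).
      by apply: open_nbhs_nbhs; split; [exact: itv_open|rewrite /= in_itv /= s0 sR].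
    have N : (s^') (`[0, R]%classic : set K).
      apply: (@nbhs_dnbhs K s); apply: filterS O => z /=.
      by rewrite !in_itv /= => /andP[/ltW -> /ltW ->].
    apply/funext => P; apply/propext; split => [H|H]; last by apply: filterS H => z.
    by apply: filterS2 N H => z Dz; apply.
  have C : (z - s)^-1 * (w (z *: e) - w (s *: e)) @[z --> s^'] --> dg s.
    apply/cvgrPdist_le => eps eps0; rewrite near_withinE.
    have [|d d0 H] := is_derive_remainder (Dg s _) eps0; first by rewrite (ltW s0).
    suff N : \forall z \near s, z != s ->
        `|dg s - (z - s)^-1 * (w (z *: e) - w (s *: e))| <= eps by [].
    apply/nbhs_normP; exists d => // z zs zns.
    have zs0 : z - s != 0 by rewrite subr_eq0.
    have := H (z - s); rewrite /g !add0r [s + _]addrC subrK distrC => /(_ zs) {}H.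
    have -> : dg s - (z - s)^-1 * (w (z *: e) - w (s *: e)) =
        - (z - s)^-1 * (w (z *: e) - w (s *: e) - (z - s) * dg s).
      by field.
    by rewrite normrM normrN normfV mulrC ler_pdivrMr ?normr_gt0 // [`|z - s|]distrC.
  by rewrite (cvg_lim _ C).
move=> lt_xy.
have D (s : K) : s \in `[enorm x, enorm y] -> is_derive s 1 g (dg s).
  rewrite in_itv /= => /andP[a b]; apply: Dg.
  by rewrite (le_trans nx0 a) (le_lt_trans b nyR).
(* The intermediate radius is strictly positive even when [x = 0], as [dg0] demands. *)
have [c] := MVT lt_xy (fun s sa => D s (subset_itv_oo_cc sa))
    (derivable_within_continuous (fun s sa => @ex_derive _ _ _ _ _ _ _ (D s sa))).
rewrite in_itv /= => /andP[c0 c1] E; rewrite -subr_ge0 E mulr_ge0 ?subr_ge0 //.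
by apply: dg0; rewrite (le_lt_trans nx0 c0) (lt_trans c1 nyR).
Qed.

(** The initial condition is imposed in the open ball; scaling both points by [s < 1] and letting
    [s] tend to 1 reaches the sphere by continuity of [u]. *)
Lemma initial_monotone (R T : K) (w : 'rV[K]_n -> K) (u : 'rV[K]_n -> K -> K) :
  0 < R -> 0 < T -> initial_datum R w -> classical_regularity R T u ->
  (forall x, eball R x -> u x 0 = w x) ->
  forall x y, cball R y -> sqn x <= sqn y -> u x 0 <= u y 0.
Proof.
move=> R0 T0 W ru uw x y yR xy.
have /(cballP _ R0) yR' := yR.
have xR : cball R x by apply/cballP => //; exact: le_trans yR'.
have scale_lt z (s : K) : cball R z -> 0 < s < 1 -> eball R (s *: z).
  move=> /(cballP _ R0) zR /andP[s0 s1]; apply/eballP => //; rewrite sqnZ.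
  apply: (@le_lt_trans _ _ (s ^+ 2 * R ^+ 2)); first by rewrite ler_wpM2l // sqr_ge0.
  by rewrite gtr_pMl ?exprn_gt0 // exprn_ilt1 // ltW.
have C z : cball R z -> u (s *: z) 0 @[s --> (1:K)^'-] --> u z 0.
  move=> zR.
  have A : (cball R `*` `[0, T[) (z, 0 : K) by split => //=; rewrite in_itv /= lexx.
  have /subspace_continuousP /(_ _ A) H := cr_cont ru.
  apply: (@cvg_comp _ _ _ (fun s : K => (s *: z, 0 : K)) (fun z => u z.1 z.2) _
    (within (cball R `*` `[0, T[) (nbhs (z, 0 : K))) _ _ H).
  apply: cvg_to_within.
    apply: (@cvg_pair _ _ _ _ (nbhs z) (nbhs (0 : K)) _ _ _ (fun s : K => s *: z) (fun=> 0)).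
      rewrite -[X in _ --> nbhs X]scale1r; apply: cvg_within_filter.
      exact: scalel_continuous.
    exact: cvg_cst.
  near=> s; split => /=; last by rewrite in_itv /= lexx.
  apply/ltW/scale_lt => //; apply/andP; split; near: s.
    exact: nbhs_left_gt.
  exact: nbhs_left_lt.
apply: (ler_cvg_to (C x xR) (C y yR)); near=> s.
have s01 : 0 < s < 1.
  by apply/andP; split; near: s; [exact: nbhs_left_gt|exact: nbhs_left_lt].
rewrite !uw; try exact: scale_lt.
apply: (initial_datum_monotone R0 W); first exact: scale_lt.
by rewrite !sqnZ ler_wpM2l // sqr_ge0.
Unshelve. all: by end_near.
Qed.

End InitialData.

(** * Doubling of the variables *)

Section RadialMonotonicity.
Context {K : realType} {n : nat}.
Implicit Types (x y z : 'rV[K]_n) (u v : 'rV[K]_n -> K -> K).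

Definition ordered_pairs (R : K) : set ('rV[K]_n * 'rV[K]_n) :=
  [set z | sqn z.1 <= sqn z.2 /\ sqn z.2 <= R ^+ 2].

Lemma ordered_pairs_compact (R : K) : 0 < R -> compact (ordered_pairs R).
Proof.
move=> R0.
have -> : ordered_pairs R =
    (cball R `*` cball R) `&` [set z | sqn z.1 - sqn z.2 <= 0].
  apply/seteqP; split => -[x y] /=.
    move=> [/= xy yR]; rewrite subr_le0; split => //; split; apply/cballP => //=.
    exact: le_trans yR.
  by move=> [[/= _ /cballP yR]]; rewrite subr_le0 => xy; split => //=; exact: yR.
apply: compact_closedI; first by apply: compact_setX; exact: cball_compact.
apply: (@closed_comp _ _ (fun z : 'rV[K]_n * 'rV[K]_n => sqn z.1 - sqn z.2)
  [set s | s <= 0]); last exact: (@closed_le K 0).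
move=> [x y] _; apply: cvgB.
  by apply: (@cvg_comp _ _ _ fst sqn _ (nbhs x)); [exact: cvg_fst|exact: sqn_continuous].
by apply: (@cvg_comp _ _ _ snd sqn _ (nbhs y)); [exact: cvg_snd|exact: sqn_continuous].
Qed.

Lemma sqn_near (a b : K) x : a < sqn x < b ->
  exists2 r : K, 0 < r & forall y, `|y - x| < r -> a < sqn y < b.
Proof.
move=> /andP[ax xb].
have : nbhs x (sqn @^-1` (`]a, b[%classic : set K)).
  apply: sqn_continuous; apply: open_nbhs_nbhs; split; first exact: itv_open.
  by rewrite /= in_itv /= ax xb.
move=> /nbhs_normP[r r0 H]; exists r => // y yx.
by have := H y; rewrite /ball_ /= distrC in_itv; apply.
Qed.

Variables (R T : K) (u : 'rV[K]_n -> K -> K).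
Hypothesis R0 : 0 < R.
Hypothesis ru : classical_regularity R T u.
Hypothesis heat : forall x (t : K), eball R x -> 0 < t < T ->
  'D_1 (u x) t = laplacian (u^~ t) x.

(** Second-order Taylor polynomial of [c exp(k (|x|^2 - R^2))]. It is at least [c / 2] everywhere,
    equals [c] on the sphere, and has normal derivative [2 R c k] there, made large through [k]. *)
Definition weight (c k : K) x : K := quad c (c * k) (c * (k ^+ 2 / 2)) R x.

Lemma weight_sphere c k x : sqn x = R ^+ 2 -> weight c k x = c.
Proof. by move=> xR; rewrite /weight /quad xR subrr expr0n /= !mulr0 !addr0. Qed.

Lemma weight_ge c k x : 0 <= c -> c / 2 <= weight c k x.
Proof.
move=> c0; have -> : weight c k x = c / 2 + c / 2 * (1 + k * (sqn x - R ^+ 2)) ^+ 2.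
  by rewrite /weight /quad; field.
by rewrite lerDl mulr_ge0 ?sqr_ge0 // divr_ge0.
Qed.

Lemma weightM c d k x : weight (c * d) k x = c * weight d k x.
Proof. by rewrite /weight /quad; ring. Qed.

Lemma lap_weight_le c k x : 0 <= c -> sqn x <= R ^+ 2 ->
  lap_quad (c * k) (c * (k ^+ 2 / 2)) R x <=
  c * (2 * n%:R * k + 4 * k ^+ 2 * R ^+ 2).
Proof.
move=> c0 xR; rewrite /lap_quad.
have H : 0 <= c * k ^+ 2 by rewrite mulr_ge0 // sqr_ge0.
have H1 : c * k ^+ 2 * sqn x <= c * k ^+ 2 * R ^+ 2 by rewrite ler_wpM2l.
have H2 : c * k ^+ 2 * (n%:R * (sqn x - R ^+ 2)) <= 0.
  by rewrite mulr_ge0_le0 // mulr_ge0_le0 // subr_le0.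
lra.
Qed.

Lemma pair_touch_interior (c k t : K) x y : 0 < t < T ->
  (forall x' y', sqn x' <= sqn y' -> sqn y' <= R ^+ 2 ->
    u x' t - u y' t - weight c k x' <= u x t - u y t - weight c k x) ->
  sqn x <= sqn y -> sqn y < R ^+ 2 ->
  'D_1 (u x) t - 'D_1 (u y) t <= lap_quad (c * k) (c * (k ^+ 2 / 2)) R x.
Proof.
move=> tT touch xy yR.
have yB : eball R y by apply/eballP.
have xB : eball R x by apply/eballP => //; exact: le_lt_trans yR.
have [xy'|xy'] : sqn x < sqn y \/ sqn x = sqn y.
    by move: xy; rewrite le_eqVlt => /orP[/eqP|]; [right|left].
(* The constraints [|x| < |y| < R] are slack, so the two points move independently. The bound [-1]
   merely places [sqn x], possibly 0, inside an open interval. *)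
- have x01 : -1 < sqn x < sqn y by rewrite xy' (lt_le_trans _ (sqn_ge0 x)) // ltrN10.
  have [r r0 rx] := sqn_near x01.
  have y01 : sqn x < sqn y < R ^+ 2 by rewrite xy'.
  have [r' r'0 ry] := sqn_near y01.
  have H1 := touch_laplacian R0 ru heat (sg := -1) (w := weight c k) xB tT
    (fun i => @sdiff2_quad K n _ _ _ R x (e_ i)) r0.
  have {H1} := H1 _; rewrite (sum_sdiff2_quad _ _ _ _ (@orthonormal_frame_delta K n)).
  have T1 z : `|z - x| < r -> -1 * (weight c k z - u z t) <= -1 * (weight c k x - u x t).
    move=> /rx /andP[_ /ltW zy]; have := touch z y zy (ltW yR); lra.
  move=> /(_ T1) H1.
  (* The zero barrier expresses that [u] has a local minimum at [y], so its Laplacian there is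
     nonnegative. *)
  have H2 := touch_laplacian R0 ru heat (sg := 1) (w := quad 0 0 0 R) yB tT
    (fun i => @sdiff2_quad K n _ _ _ R y (e_ i)) r'0.
  have {H2} := H2 _; rewrite (sum_sdiff2_quad _ _ _ _ (@orthonormal_frame_delta K n)).
  have T2 z : `|z - y| < r' -> 1 * (quad 0 0 0 R z - u z t) <= 1 * (quad 0 0 0 R y - u y t).
    move=> /ry /andP[/ltW xz /ltW zR]; have := touch x z xz zR.
    rewrite /quad; lra.
  have -> : lap_quad 0 0 R y = 0 by rewrite /lap_quad; ring.
  by move=> /(_ T2); lra.
(* The constraint is now binding. Pairs [(z, z *m Q)] remain admissible, and the frame [e_ i *m Q]
   at [y] still computes the Laplacian. *)
have [Q [xO OOT OTO]] := rotation_exists xy'.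
have [Hx cx <-] := heat_second_differences R0 ru heat xB tT (@orthonormal_frame_delta K n).
have [Hy cy <-] := heat_second_differences R0 ru heat yB tT (frame_rotation OTO).
rewrite -(sum_sdiff2_quad _ _ _ _ (@orthonormal_frame_delta K n)) -sumrB.
apply: ler_sum => i _.
apply: (ler_cvg_to (cvgB (cx i) (cy i)) (@sdiff2_quad K n c _ _ R x (e_ i))).
have [r r0 rx] := eball_line R0 xB.
have := line_near x (e_ i) r0; apply: filterS => h [/rx h1 /rx h2].
have D : sdiff2 (u^~ t) x (e_ i) h - sdiff2 (u^~ t) y (e_ i *m Q) h <=
    sdiff2 (weight c k) x (e_ i) h.
  have yz (s : K) : y + s *: (e_ i *m Q) = (x + s *: e_ i) *m Q.
    by rewrite mulmxDl xO -scalemxAl.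
  have yz' (s : K) : y - s *: (e_ i *m Q) = (x - s *: e_ i) *m Q.
    by rewrite mulmxBl xO -scalemxAl.
  rewrite /sdiff2 -mulrBl ler_wpM2r ?invr_ge0 ?sqr_ge0 // yz yz'.
  have t1 : u (x + h *: e_ i) t - u ((x + h *: e_ i) *m Q) t - weight c k (x + h *: e_ i)
      <= u x t - u y t - weight c k x.
    by apply: touch; rewrite sqn_rotation //; apply/ltW/eballP.
  have t2 : u (x - h *: e_ i) t - u ((x - h *: e_ i) *m Q) t - weight c k (x - h *: e_ i)
      <= u x t - u y t - weight c k x.
    by apply: touch; rewrite sqn_rotation //; apply/ltW/eballP.
  lra.
exact: D.
Qed.

(** Moving both points inward by the same distance keeps their norms equal, so the pair stays
    admissible. *)
Lemma pair_touch_sphere (c k t lx ly : K) x y :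
  (forall x' y', sqn x' <= sqn y' -> sqn y' <= R ^+ 2 ->
    u x' t - u y' t - weight c k x' <= u x t - u y t - weight c k x) ->
  esphere R x -> esphere R y ->
  has_normal_derivative (u^~ t) x lx -> has_normal_derivative (u^~ t) y ly ->
  2 * R * (c * k) <= lx - ly.
Proof.
move=> touch xS yS Hx Hy.
have Hq := @quad_normal_derivative K n c (c * k) (c * (k ^+ 2 / 2)) R x R0 xS.
apply: (ler_cvg_to Hq (cvgB Hx Hy)).
near=> h.
have h0 : 0 < h by [].
have hR : h < R by near: h; exact: nbhs_right_lt.
have hh : 0 <= h <= R by rewrite !ltW.
have := touch (x - h *: outward_normal x) (y - h *: outward_normal y).
rewrite (sqn_inward R0 xS hh) (sqn_inward R0 yS hh) lexx => /(_ isT).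
have -> : (R - h) ^+ 2 <= R ^+ 2 by rewrite ler_pXn2r // ?nnegrE; lra.
move=> /(_ isT) {}touch.
have D : h^-1 * (weight c k x - weight c k (x - h *: outward_normal x)) <=
    h^-1 * (u x t - u (x - h *: outward_normal x) t) -
    h^-1 * (u y t - u (y - h *: outward_normal y) t).
  by rewrite -mulrBr ler_wpM2l ?invr_ge0 ?(ltW h0) //; lra.
exact: D.
Unshelve. all: by end_near.
Qed.

(** With [x] fixed inside, [y] may move inward as long as its norm exceeds that of [x]; [u] does not
    decrease along the way. *)
Lemma pair_touch_outer (c k t ly : K) x y :
  (forall x' y', sqn x' <= sqn y' -> sqn y' <= R ^+ 2 ->
    u x' t - u y' t - weight c k x' <= u x t - u y t - weight c k x) ->
  sqn x < R ^+ 2 -> esphere R y -> has_normal_derivative (u^~ t) y ly -> ly <= 0.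
Proof.
move=> touch xR yS Hy.
have xE : enorm x < R by apply/(eballP x R0).
have x0 : 0 <= enorm x := sqrtr_ge0 _.
have Rx : 0 < R - enorm x by rewrite subr_gt0.
rewrite -[leRHS](mulr0 (2 * R)).
apply: (touch_normal Rx (@quad_normal_derivative _ _ 0 0 0 R y R0 yS) Hy).
move=> h /andP[h0 hR].
have hh : 0 <= h <= R by rewrite (ltW h0); lra.
have := touch x (y - h *: outward_normal y); rewrite (sqn_inward R0 yS hh).
have -> : sqn x <= (R - h) ^+ 2.
  rewrite -(sqr_sqrtr (sqn_ge0 x)) -/(enorm x) ler_pXn2r // ?nnegrE; lra.
have -> : (R - h) ^+ 2 <= R ^+ 2 by rewrite ler_pXn2r // ?nnegrE; lra.
move=> /(_ isT isT); rewrite /quad; lra.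
Qed.

Lemma pair_no_touch (eps k la t L : K) (flux : 'rV[K]_n -> K) x y :
  0 < eps -> 0 <= k -> 0 < t < T -> sqn x <= sqn y -> sqn y <= R ^+ 2 ->
  2 * (2 * n%:R * k + 4 * k ^+ 2 * R ^+ 2) < la -> L < 2 * R * k ->
  (forall z, esphere R z -> 0 < flux z /\ has_normal_derivative (u^~ t) z (flux z)) ->
  u x t - u y t = weight (eps * expR (la * t)) k x ->
  (forall x' y' s, sqn x' <= sqn y' -> sqn y' <= R ^+ 2 -> 0 <= s <= t ->
    u x' s - u y' s <= weight (eps * expR (la * s)) k x') ->
  (esphere R x -> esphere R y -> flux x - flux y <= L * (eps * expR (la * t))) ->
  False.
Proof.
move=> eps0 k0 tT xy yR la_gt L_lt fluxP E le Lip.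
have t0 : 0 < t by move: tT => /andP[].
pose c := eps * expR (la * t).
have c0 : 0 < c by rewrite mulr_gt0 // expR_gt0.
have touch x' y' : sqn x' <= sqn y' -> sqn y' <= R ^+ 2 ->
    u x' t - u y' t - weight c k x' <= u x t - u y t - weight c k x.
  move=> xy' yR'; rewrite E subrr subr_le0; apply: le => //.
  by rewrite (ltW t0) lexx.
have [yb|yS] : sqn y < R ^+ 2 \/ sqn y = R ^+ 2.
    by move: yR; rewrite le_eqVlt => /orP[/eqP|]; [right|left].
- have yB : eball R y by apply/eballP.
  have xB : eball R x by apply/eballP => //; exact: le_lt_trans yb.
  have Dx := derivableP (cr_dert ru xB tT).
  have Dy := derivableP (cr_dert ru yB tT).
  have De : is_derive t 1 (fun s => weight (eps * expR (la * s)) k x)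
      (la * weight c k x).
    have -> : (fun s => weight (eps * expR (la * s)) k x) =
        weight eps k x *: (expR \o ( *%R la)).
      apply/funext => s; rewrite !fctE /GRing.scale /=.
      by rewrite [eps * _]mulrC weightM mulrC.
    have D1 : is_derive t 1 ( *%R la) la.
      have -> : ( *%R la) = (fun s => 0 + la * s) by apply/funext => s; rewrite add0r.
      exact: is_derive_affine.
    have D2 := @is_derive1_comp K expR ( *%R la) t _ _ (is_derive_expR _) D1.
    apply: (is_derive_eq (is_deriveZ (weight eps k x) D2)).
    by rewrite /GRing.scale /= /c [eps * _]mulrC weightM; ring.
  (* Touching in time gives [la * weight] at most the difference of the time derivatives, hence at
     most the Laplacian of the weight. Since the weight is at least [c / 2], the factor 2 in the
     lower bound on [la] excludes this. *)
  have H : 0 <= 'D_1 (u x) t - 'D_1 (u y) t - la * weight c k x.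
    apply: (is_derive_ge0_left (is_deriveB (is_deriveB Dx Dy) De) t0) => s sI.
    have := le x y s xy yR sI; rewrite !fctE E subrr; lra.
  have H1 := pair_touch_interior tT touch xy yb.
  have H2 := lap_weight_le k (ltW c0) (le_trans xy (ltW yb)).
  have H3 := weight_ge k x (ltW c0).
  have la0 : 0 <= la.
    apply: le_trans (ltW la_gt); rewrite mulr_ge0 // addr_ge0 //.
      by rewrite mulr_ge0 // mulr_ge0.
    by rewrite mulr_ge0 ?sqr_ge0 // mulr_ge0 ?sqr_ge0.
  have : la * (c / 2) <= la * weight c k x by rewrite ler_wpM2l.
  have : c * (2 * (2 * n%:R * k + 4 * k ^+ 2 * R ^+ 2)) < c * la by rewrite ltr_pM2l.
  lra.
have yS' : esphere R y by apply/esphereP.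
have [fy0 fyD] := fluxP y yS'.
have [xb|xS] : sqn x < R ^+ 2 \/ sqn x = R ^+ 2.
    by move: (le_trans xy yR); rewrite le_eqVlt => /orP[/eqP|]; [right|left].
  by have := pair_touch_outer touch xb yS' fyD; rewrite leNgt fy0.
have xS' : esphere R x by apply/esphereP.
have [_ fxD] := fluxP x xS'.
have := pair_touch_sphere touch xS' yS' fxD fyD; have := Lip xS' yS'.
have : L * c < 2 * R * k * c by rewrite ltr_pM2r.
rewrite -/c; lra.
Qed.

End RadialMonotonicity.

Lemma within_continuous_comp_sub {X Y Z : topologicalType} (A : set X) (B : set Y)
    (f : X -> Y) (g : Y -> Z) :
  continuous f -> (forall x, A x -> B (f x)) -> {within B, continuous g} ->
  {within A, continuous (g \o f)}.
Proof.
move=> cf fAB /subspace_continuousP cg; apply/subspace_continuousP => x Ax.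
apply: cvg_comp (cg _ (fAB _ Ax)); apply: cvg_to_within.
  by apply: cvg_within_filter; exact: cf.
by apply: filterS (withinT A (nbhs_filter x)) => z; exact: fAB.
Qed.

(** * Radial monotonicity of solutions and boundedness inside the ball *)

Section Conclusion.
Context {K : realType} {n : nat}.
Implicit Types (x y z : 'rV[K]_n) (u v : 'rV[K]_n -> K -> K).

Lemma pair_difference_continuous (R T t1 c k la : K) u : 0 < R ->
  classical_regularity R T u -> t1 < T ->
  {within ordered_pairs R `*` `[0, t1],
    continuous (fun z : 'rV[K]_n * 'rV[K]_n * K =>
      u z.1.1 z.2 - u z.1.2 z.2 - weight R (c * expR (la * z.2)) k z.1.1)}.
Proof.
move=> R0 ru t1T.
have cu := solution_continuous ru (lexx 0) t1T.
have fst2 : continuous (fun z : 'rV[K]_n * 'rV[K]_n * K => z.1.1).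
  by move=> z; apply: (@cvg_comp _ _ _ fst fst _ (nbhs z.1)); exact: cvg_fst.
have snd2 : continuous (fun z : 'rV[K]_n * 'rV[K]_n * K => z.1.2).
  move=> z; apply: (@cvg_comp _ _ _ fst snd _ (nbhs z.1)); [exact: cvg_fst|exact: cvg_snd].
have snd1 : continuous (fun z : 'rV[K]_n * 'rV[K]_n * K => z.2).
  by move=> z; exact: cvg_snd.
have c1 : {within ordered_pairs R `*` `[0, t1],
    continuous (fun z : 'rV[K]_n * 'rV[K]_n * K => u z.1.1 z.2)}.
  apply: (@within_continuous_comp_sub _ _ _ (ordered_pairs R `*` `[0, t1])
    (cball R `*` `[0, t1]) (fun a => (a.1.1, a.2)) (fun a => u a.1 a.2) _ _ cu).
    by move=> z; exact: (cvg_pair (fst2 z) (snd1 z)).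
  move=> [[x y] t] [[/= xy yR] tI]; split => //=; apply/cballP => //; exact: le_trans yR.
have c2 : {within ordered_pairs R `*` `[0, t1],
    continuous (fun z : 'rV[K]_n * 'rV[K]_n * K => u z.1.2 z.2)}.
  apply: (@within_continuous_comp_sub _ _ _ (ordered_pairs R `*` `[0, t1])
    (cball R `*` `[0, t1]) (fun a => (a.1.2, a.2)) (fun a => u a.1 a.2) _ _ cu).
    by move=> z; exact: (cvg_pair (snd2 z) (snd1 z)).
  by move=> [[x y] t] [[/= xy yR] tI]; split => //=; apply/cballP.
apply: within_continuousB; first exact: (within_continuousB c1 c2).
apply: continuous_subspaceT => z.
have -> : (fun z : 'rV[K]_n * 'rV[K]_n * K => weight R (c * expR (la * z.2)) k z.1.1) =
    (fun a => c * expR (la * a.2) * weight R 1 k a.1.1).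
  by apply/funext => z'; rewrite -weightM mulr1.
apply: cvgM.
  apply: cvgM; first exact: cvg_cst.
  apply: (@cvg_comp _ _ _ (fun a => la * a.2) expR _ (nbhs (la * z.2))).
    by apply: cvgM; [exact: cvg_cst|exact: snd1].
  exact: continuous_expR.
have S : sqn z'.1.1 - R ^+ 2 @[z' --> nbhs z] --> sqn z.1.1 - R ^+ 2.
  apply: cvgB; last exact: cvg_cst.
  by apply: (@cvg_comp _ _ _ (fun a => a.1.1) sqn _ (nbhs z.1.1));
    [exact: fst2|exact: sqn_continuous].
rewrite /weight /quad; apply: cvgD; first apply: cvgD.
- exact: cvg_cst.
- by apply: cvgM => //; exact: cvg_cst.
- apply: cvgM; first exact: cvg_cst.
  by rewrite !expr2; exact: (cvgM S S).
Qed.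

Lemma solution_radial_monotone (p q R T : K) (u0 v0 : 'rV[K]_n -> K) u v :
  (0 < n)%N -> 1 < p -> 1 < q -> 0 < R -> initial_datum R u0 -> initial_datum R v0 ->
  solution p q R u0 v0 T u v ->
  forall x y t, 0 <= t < T -> cball R y -> sqn x <= sqn y ->
    u x t <= u y t /\ v x t <= v y t.
Proof.
move=> n_gt0 p1 q1 R0 U0 V0 sol x1 y1 t1 /andP[t10 t1T] y1R xy1.
have T0 : 0 < T := sol_T_gt0 sol.
have [mu mu_le] := solution_bounded R0 (sol_regu sol) t1T.
have [mv mv_le] := solution_bounded R0 (sol_regv sol) t1T.
have [Lp Lp0 lipp] := flux_lipschitz mv p1.
have [Lq Lq0 lipq] := flux_lipschitz mu q1.
(* One constant serves both fluxes, and [k] is chosen so that [2 R k = L + 1] exceeds it. *)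
pose L := Lp + Lq; pose k : K := (L + 1) / (2 * R).
have L0 : 0 < L by rewrite addr_gt0.
have k0 : 0 <= k by rewrite divr_ge0 //; [lra|rewrite mulr_ge0 // ltW].
have Lk : L < 2 * R * k.
  have -> : 2 * R * k = L + 1 by rewrite /k; field; exact: lt0r_neq0.
  by rewrite ltrDl.
pose la : K := 2 * (2 * n%:R * k + 4 * k ^+ 2 * R ^+ 2) + 1.
have laP : 2 * (2 * n%:R * k + 4 * k ^+ 2 * R ^+ 2) < la by rewrite ltrDl.
(* The factor [eps] makes the inequalities strict at time 0, as a first touching argument requires;
   since it is arbitrary, the differences are at most 0. *)
suff H (eps : K) : 0 < eps -> forall (z : 'rV[K]_n * 'rV[K]_n) t,
    ordered_pairs R z -> 0 <= t <= t1 ->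
    u z.1 t - u z.2 t < weight R (eps * expR (la * t)) k z.1 /\
    v z.1 t - v z.2 t < weight R (eps * expR (la * t)) k z.1.
  have W0 : 0 < weight R (expR (la * t1)) k x1.
    by apply: lt_le_trans (weight_ge R k x1 (expR_ge0 _)); rewrite divr_gt0 // expR_gt0.
  have zO : ordered_pairs R (x1, y1) by split => //=; apply/cballP.
  have tt : 0 <= t1 <= t1 by rewrite t10 lexx.
  have fin (d : K) : (forall eps, 0 < eps -> d < eps * weight R (expR (la * t1)) k x1) -> d <= 0.
    move=> dlt; rewrite leNgt; apply/negP => d0.
    have := dlt (d / weight R (expR (la * t1)) k x1); rewrite divr_gt0 // => /(_ isT).
    by rewrite divfK ?ltxx // lt0r_neq0.
  split; rewrite -subr_le0; apply: fin => eps /H /(_ _ _ zO tt) [];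
    by rewrite -weightM.
move=> eps0 z0 t0 z0O t0I; apply: contrapT => nlt.
have in0 := initial_monotone n_gt0 R0 T0.
have [] := @first_touch_pair K _ (ordered_pairs R) 0 t1
  (fun a => u a.1.1 a.2 - u a.1.2 a.2 - weight R (eps * expR (la * a.2)) k a.1.1)
  (fun a => v a.1.1 a.2 - v a.1.2 a.2 - weight R (eps * expR (la * a.2)) k a.1.1)
  (ordered_pairs_compact R0)
  (@pair_difference_continuous R T t1 eps k la u R0 (sol_regu sol) t1T)
  (@pair_difference_continuous R T t1 eps k la v R0 (sol_regv sol) t1T).
- move=> [x y] [/= xy yR]; have yB : cball R y by apply/cballP.
  have := in0 _ _ U0 (sol_regu sol) (sol_initu sol) x y yB xy.
  have := in0 _ _ V0 (sol_regv sol) (sol_initv sol) x y yB xy.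
  have e0 : 0 < eps * expR (la * 0) by rewrite mulr_gt0 // expR_gt0.
  have := weight_ge R k x (ltW e0); lra.
- exists z0, t0; split => //=; rewrite !subr_ge0.
  have [H1|H1] := leP (weight R (eps * expR (la * t0)) k z0.1) (u z0.1 t0 - u z0.2 t0).
    by left.
  by right; rewrite leNgt; apply/negP => H2; apply: nlt.
move=> [x y] [t [[/= xy yR] /andP[tpos tt1] E le]].
have tT : 0 < t < T by rewrite tpos (le_lt_trans tt1 t1T).
have tI : 0 <= t <= t1 by rewrite (ltW tpos).
have tI' : 0 <= t < T by rewrite (ltW tpos) (le_lt_trans tt1 t1T).
have leu x' y' s : sqn x' <= sqn y' -> sqn y' <= R ^+ 2 -> 0 <= s <= t ->
    u x' s - u y' s <= weight R (eps * expR (la * s)) k x'.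
  by move=> xy' yR' sI; have [] := le (x', y') s (conj xy' yR') sI; rewrite /= subr_le0.
have lev x' y' s : sqn x' <= sqn y' -> sqn y' <= R ^+ 2 -> 0 <= s <= t ->
    v x' s - v y' s <= weight R (eps * expR (la * s)) k x'.
  by move=> xy' yR' sI; have [] := le (x', y') s (conj xy' yR') sI; rewrite /= !subr_le0.
have e0 : 0 <= eps * expR (la * t) by rewrite mulr_ge0 ?expR_ge0 // ltW.
have tt : 0 <= t <= t by rewrite (ltW tpos) lexx.
have sC z : esphere R z -> cball R z by rewrite /esphere /cball /= => ->.
have uI z : esphere R z -> 0 <= u z t <= mu.
  by move=> /sC zR; rewrite (sol_u_ge0 sol zR tI') mu_le.
have vI z : esphere R z -> 0 <= v z t <= mv.
  by move=> /sC zR; rewrite (sol_v_ge0 sol zR tI') mv_le.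
(* When one component touches, the other still satisfies its weak bound. On the sphere that bound is
   [eps * expR (la * t)], and the Lipschitz estimate converts it into the flux difference. *)
case: E => /eqP; rewrite subr_eq0 => /eqP E.
- apply: (@pair_no_touch K n R T u R0 (sol_regu sol) (sol_heatu sol) eps k la t L
    (fun z => expR (v z t `^ p)) x y) => //.
    by move=> z zS; split; [exact: expR_gt0|exact: sol_bdu sol _ _ zS tT].
  move=> xS yS.
  apply: (@le_trans _ _ (Lp * (eps * expR (la * t)))); last first.
    by rewrite ler_wpM2r // /L lerDl ltW.
  apply: lipp => //; [exact: vI|exact: vI|].
  by have := lev x y t xy yR tt; rewrite (weight_sphere _ _ ((esphereP x R0).1 xS)).
- apply: (@pair_no_touch K n R T v R0 (sol_regv sol) (sol_heatv sol) eps k la t L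
    (fun z => expR (u z t `^ q)) x y) => //.
    by move=> z zS; split; [exact: expR_gt0|exact: sol_bdv sol _ _ zS tT].
  move=> xS yS.
  apply: (@le_trans _ _ (Lq * (eps * expR (la * t)))); last first.
    by rewrite ler_wpM2r // /L lerDr ltW.
  apply: lipq => //; [exact: uI|exact: uI|].
  by have := leu x y t xy yR tt; rewrite (weight_sphere _ _ ((esphereP x R0).1 xS)).
Qed.

(** Stated for the first component; the bound for the second comes from exchanging the roles through
    [solution_sym]. *)
Lemma component_interior_bound (p q R T r r' : K) (u0 v0 : 'rV[K]_n -> K) u v :
  (0 < n)%N -> 1 < p -> 1 < q -> 0 < r' < r -> r < R ->
  initial_datum R u0 -> initial_datum R v0 -> solution p q R u0 v0 T u v ->
  exists B, forall x t, sqn x <= r' ^+ 2 -> 0 <= t < T -> u x t <= B.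
Proof.
move=> n_gt0 p1 q1 /andP[r'0 r'r] rR U0 V0 sol.
have r0 := lt_trans r'0 r'r; have R0 := lt_trans r0 rR.
have mono x y t (tT : 0 <= t < T) (yR : cball R y) (xy : sqn x <= sqn y) : u x t <= u y t.
  by have [] := solution_radial_monotone n_gt0 p1 q1 R0 U0 V0 sol tT yR xy.
have rR' : 0 < r < R by rewrite r0.
have [C C0 rate] := rate_bound n_gt0 p1 q1 rR' sol mono.
apply: (interior_bound _ rR (sol_T_gt0 sol) C0 (sol_regu sol) (sol_heatu sol) rate).
by rewrite r'0.
Qed.

End Conclusion.

Theorem theorem4p2 (K : realType) (n : nat) (p q R T : K)
    (u0 v0 : 'rV[K]_n -> K) (u v : 'rV[K]_n -> K -> K)
    (n_gt0 : (0 < n)%N) (p_gt1 : 1 < p) (q_gt1 : 1 < q) (R_gt0 : 0 < R)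
    (u0_datum : initial_datum R u0) (v0_datum : initial_datum R v0)
    (uv_sol : solution p q R u0 v0 T u v)
    (uv_blow_up : blows_up_at p q R u0 v0 T u v) :
  forall x : 'rV[K]_n, blow_up_point R T u v x -> esphere R x.
Proof.
move=> x [xR [y [s [ysR yx _ blow]]]].
move: xR; rewrite /cball /= le_eqVlt => /orP[/eqP //|xR]; exfalso.
have x0 : 0 <= enorm x := sqrtr_ge0 _.
(* Two radii are needed between [|x|] and [R]: the rate holds up to [r], the uniform bound up to
   [r']. They cut the gap into thirds. *)
have [r' [r [r'0 xr' r'r rR]]] : exists r' r : K,
    [/\ 0 < r', enorm x < r', r' < r & r < R].
  exists (enorm x + (R - enorm x) / 3), (enorm x + (R - enorm x) / 3 * 2).
  by split; lra.
have r'r' : 0 < r' < r by rewrite r'0.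
have [Bu ub] := component_interior_bound n_gt0 p_gt1 q_gt1 r'r' rR u0_datum v0_datum uv_sol.
have [Bv vb] := component_interior_bound n_gt0 q_gt1 p_gt1 r'r' rR v0_datum u0_datum
  (solution_sym uv_sol).
have near_x : \forall k \near \oo, eball r' (y k).
  apply: yx; apply: open_nbhs_nbhs; split => //; exact: eball_open.
(* Near an interior point both components are bounded by [Bu] and [Bv] for all times, so their sum
   cannot exceed [Bu + Bv]. *)
have large : \forall k \near \oo, Bu + Bv < u (y k) (s k) + v (y k) (s k).
  by move/cvgryPgt : blow; apply.
have [k [yk big]] := filter_ex (filterI near_x large).
have [_ /andP[s0 sT]] := ysR k.
have /(eballP _ r'0)/ltW yk' := yk.
have sI : 0 <= s k < T by rewrite ltW.
have := ub _ _ yk' sI; have := vb _ _ yk' sI; move: big; rewrite /=; lra.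
Qed.
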